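(* For each $\delta\in(0,\overline\delta)$ and each $f\in L^q(\Omega)$, the problem $$\inf_{\kappa\in\mathbb{A}_\delta}\hat\imath_\delta(\kappa),\qquad \hat\imath_\delta(\kappa)=\inf_{\sigma\in\mathbb{Q}_\delta(f)}\frac1q\int_{\Omega_\delta}\int_{\Omega_\delta}\kappa^{1-q}(x,x')|\sigma(x,x')|^q\,dx\,dx',$$ admits an optimal solution $\kappa^*\in\mathbb{A}_\delta$.
   Context: Fix an integer $n\ge 2$, exponents $1<p<\infty$ and $q$ with $1/p+1/q=1$, and a connected bounded open Lipschitz domain $\Omega\subset\mathbb{R}^n$. Kernels. For $\delta>0$ let $\Omega_\delta=\bigcup_{x\in\Omega}B(x,\delta)$, and let $\omega_\delta:\mathbb{R}^n\to[0,\infty)$ be a radial kernel supported in $B(0,\delta)$ with $\int_{\mathbb{R}^n}|x|^p\omega_\delta^p(x)\,dx=K_{p,n}^{-1}$, where $K_{p,n}=|\mathbb{S}^{n-1}|^{-1}\int_{\mathbb{S}^{n-1}}|e\cdot s|^p\,ds$ ($e\in\mathbb{S}^{n-1}$ arbitrary). Nonlocal gradient. Functions are extended by zero outside their explicit domain of definition. For $u\in L^p(\Omega)$ put $\mathcal{G}_\delta u(x,x')=[u(x)-u(x')]\omega_\delta(x-x')$, and $\mathbb{U}_{\delta,0}=\{u\in L^p(\Omega):\mathcal{G}_\delta u\in L^p(\Omega_\delta\times\Omega_\delta)\}$, which is dense in $L^p(\Omega)$. There are constants $\overline{\delta}>0$, $C>0$ with $\|u\|_{L^p(\Omega)}\le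 C\|\mathcal{G}_\delta u\|_{L^p(\Omega_\delta\times\Omega_\delta)}$ for all $u\in\mathbb{U}_{\delta,0}$, $\delta\in(0,\overline\delta)$ (known nonlocal Poincaré inequality). Nonlocal divergence. $\mathcal{D}_\delta:\mathbb{Q}_\delta=D(\mathcal{D}_\delta)\subset L^q(\Omega_\delta\times\Omega_\delta)\to L^q(\Omega)$ is the negative adjoint of $\mathcal{G}_\delta$: $\sigma\in\mathbb{Q}_\delta$ iff there is $g=:\mathcal{D}_\delta\sigma\in L^q(\Omega)$ with $\int_\Omega g u\,dx=-\int_{\Omega_\delta}\int_{\Omega_\delta}\sigma\,\mathcal{G}_\delta u\,dx\,dx'$ for all $u\in\mathbb{U}_{\delta,0}$. Put $\mathbb{Q}_\delta(f)=\{\sigma\in\mathbb{Q}_\delta:\mathcal{D}_\delta\sigma=f\}$. Conductivities. $\mathbb{A}_\delta\subset L^\infty(\Omega_\delta\times\Omega_\delta)$ is a nonempty, convex, weakly$^*$ compact set such that every $\kappa\in\mathbb{A}_\delta$ satisfies $\underline\kappa\le\kappa(x,x')\le\overline\kappa$ and $\kappa(x,x')=\kappa(x',x)$ for a.e. $(x,x')$, with fixed constants $0<\underline\kappa\le\overline\kappa<\infty$. *)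

(* Defs.v *)
From HB Require Import structures.
From mathcomp Require Import all_boot all_order all_algebra.
From mathcomp Require Import all_classical all_reals all_analysis.
From mathcomp Require Import measurable_realfun.

Set Implicit Arguments.
Unset Strict Implicit.
Unset Printing Implicit Defensive.
Import Order.TTheory GRing.Theory Num.Theory.
Import numFieldNormedType.Exports.

Local Open Scope classical_set_scope.
Local Open Scope ring_scope.

(* R^n is 'rV[R]_n.  Its library norm `|x| is the sup norm, hence the separate
   Euclidean norm; the two induce the same (library) topology. *)
Section euclidean.
Context {R : realType} {n : nat}.
Implicit Types x y : 'rV[R]_n.

Definition edot x y : R := \sum_(i < n) x 0 i * y 0 i.
Definition enorm x : R := Num.sqrt (edot x x).
Definition eball x (r : R) : set 'rV[R]_n := [set y | enorm (y - x) < r].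
Definition esphere : set 'rV[R]_n := [set x | enorm x = 1].

End euclidean.

Definition rV_display : measure_display. Proof. exact. Qed.

(* The sigma-algebra generated by the coordinates, i.e. the Borel one. *)
Section measurable_rV.
Context {R : realType} {n : nat}.

Definition rV_measurable : set (set 'rV[R]_n) :=
  g_sigma_preimage (fun (i : 'I_n) (x : 'rV[R]_n) => x 0 i).

Let rV_set0 : rV_measurable set0.
Proof. exact: sigma_algebra0. Qed.

Let rV_setC A : rV_measurable A -> rV_measurable (~` A).
Proof. exact: sigma_algebraC. Qed.

Let rV_bigcup (F : (set 'rV[R]_n)^nat) : (forall i, rV_measurable (F i)) ->
  rV_measurable (\bigcup_i (F i)).
Proof. exact: sigma_algebra_bigcup. Qed.

HB.instance Definition _ := @isMeasurable.Build rV_display 'rV[R]_n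
  rV_measurable rV_set0 rV_setC rV_bigcup.

End measurable_rV.

Section measurable_rV_theory.
Context {R : realType}.

Lemma measurable_coord n (i : 'I_n) :
  measurable_fun [set: 'rV[R]_n] (fun x : 'rV[R]_n => x 0 i).
Proof.
move=> _ Y mY; rewrite setTI; apply: sub_sigma_algebra => /=.
rewrite -bigcup_seq/=; exists i => /=; first by rewrite mem_index_enum.
by exists Y => //; rewrite setTI.
Qed.

Lemma measurable_fun_rV d (T : measurableType d) n (f : T -> 'rV[R]_n) :
  (forall i, measurable_fun [set: T] (fun t => f t 0 i)) ->
  measurable_fun [set: T] f.
Proof.
move=> mf _ A mA; rewrite setTI.
suff : g_sigma_preimage (fun i => (fun x : 'rV[R]_n => x 0 i) \o f)
    `<=` measurable.
  by apply; rewrite g_sigma_preimage_comp; exists A => //; rewrite setTI.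
apply: smallest_sub; first exact: sigma_algebra_measurable.
case: n => [|n] in f mf A mA *; first by rewrite big_ord0.
rewrite -bigcup_mkord_ord; apply: bigcup_sub => i Ii.
by move=> B [C mC <-]; exact: mf.
Qed.

End measurable_rV_theory.

(* Lebesgue measure on R^n, as the n-fold product of the one on R. *)
Section lebesgue_rV.
Context {R : realType}.

Definition rV_cons {n} (z : R * 'rV[R]_n) : 'rV[R]_n.+1 :=
  \row_i oapp (z.2 0) z.1 (unlift ord0 i).

Definition rV_uncons {n} (x : 'rV[R]_n.+1) : R * 'rV[R]_n :=
  (x 0 ord0, \row_i x 0 (lift ord0 i)).

Lemma rV_cons0 n (z : R * 'rV[R]_n) : rV_cons z 0 ord0 = z.1.
Proof. by rewrite mxE unlift_none. Qed.

Lemma rV_consS n (z : R * 'rV[R]_n) i : rV_cons z 0 (lift ord0 i) = z.2 0 i.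
Proof. by rewrite mxE liftK. Qed.

Lemma rV_consK n : cancel (@rV_cons n) rV_uncons.
Proof.
move=> [a x]; rewrite /rV_uncons rV_cons0; congr pair.
by apply/rowP => i; rewrite mxE rV_consS.
Qed.

Lemma measurable_rV_cons n : measurable_fun [set: R * 'rV[R]_n] rV_cons.
Proof.
apply: measurable_fun_rV => i.
case: (unliftP ord0 i) => [j ->|->].
- rewrite (_ : (fun _ => _) = (fun x : 'rV[R]_n => x 0 j) \o snd).
    by apply: measurableT_comp => //; exact: measurable_coord.
  by apply/funext => z; rewrite rV_consS.
- by rewrite (_ : (fun _ => _) = fst)//; apply/funext => z; rewrite rV_cons0.
Qed.

Lemma measurable_rV_uncons n : measurable_fun [set: 'rV[R]_n.+1] rV_uncons.
Proof.
apply/measurable_fun_pairP; split; first exact: measurable_coord.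
apply: measurable_fun_rV => i.
rewrite (_ : (fun _ => _) = fun x : 'rV[R]_n.+1 => x 0 (lift ord0 i)).
  exact: measurable_coord.
by apply/funext => x /=; rewrite mxE.
Qed.

Section step.
Variables (n : nat) (mu : {sigma_finite_measure set 'rV[R]_n -> \bar R}).

Definition lebesgue_rV_step : set 'rV[R]_n.+1 -> \bar R :=
  pushforward (@lebesgue_measure R \x mu)%E rV_cons.

Let step0 : lebesgue_rV_step set0 = 0%E.
Proof. by rewrite /lebesgue_rV_step /pushforward preimage_set0 measure0. Qed.

Let step_ge0 A : (0 <= lebesgue_rV_step A)%E.
Proof. by rewrite /lebesgue_rV_step /pushforward; exact: measure_ge0. Qed.

Let step_sigma_additive : semi_sigma_additive lebesgue_rV_step.
Proof.
move=> F mF tF mUF; rewrite /lebesgue_rV_step /pushforward preimage_bigcup.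
have mpre A : measurable A -> measurable (@rV_cons n @^-1` A).
  by move=> mA; rewrite -[X in measurable X]setTI; exact: measurable_rV_cons.
apply: measure_semi_sigma_additive.
- by move=> k; exact: mpre.
- apply/trivIsetP => /= i j _ _ ij; rewrite -preimage_setI.
  by move/trivIsetP : tF => /(_ _ _ _ _ ij) ->//; rewrite preimage_set0.
- by rewrite -preimage_bigcup; exact: mpre.
Qed.

HB.instance Definition _ := isMeasure.Build _ _ _ lebesgue_rV_step
  step0 step_ge0 step_sigma_additive.

Let step_sigma_finite : sigma_finite setT lebesgue_rV_step.
Proof.
have /sigma_finiteP[F [FT ndF Foo]] := sigma_finiteT (@lebesgue_measure R).
have /sigma_finiteP[G [GT ndG Goo]] := sigma_finiteT mu.
exists (fun k => @rV_uncons n @^-1` (F k `*` G k)).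
  rewrite -preimage_bigcup -(@preimage_setT _ _ rV_uncons); congr (_ @^-1` _).
  apply/seteqP; split=> // -[a x] _.
  have [k _ Fka] : (\bigcup_k F k) a by rewrite -FT.
  have [l _ Glx] : (\bigcup_k G k) x by rewrite -GT.
  exists (maxn k l) => //; split=> /=.
    by move: Fka; exact/subsetPset/ndF/leq_maxl.
  by move: Glx; exact/subsetPset/ndG/leq_maxr.
move=> k; have [mF muF] := Foo k; have [mG muG] := Goo k; split.
  rewrite -[X in measurable X]setTI; apply: measurable_rV_uncons => //.
  exact: measurableX.
rewrite /lebesgue_rV_step /pushforward -comp_preimage.
rewrite (_ : rV_uncons \o rV_cons = id); last first.
  by apply/funext => z; exact: rV_consK.
rewrite preimage_id.
by rewrite product_measure1E// lte_mul_pinfty// ge0_fin_numE.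
Qed.

HB.instance Definition _ := Measure_isSigmaFinite.Build _ _ _ lebesgue_rV_step
  step_sigma_finite.

End step.

Fixpoint lebesgue_rV n : {sigma_finite_measure set 'rV[R]_n -> \bar R} :=
  if n is n'.+1 then lebesgue_rV_step (lebesgue_rV n')
  else \d_(0 : 'rV[R]_0).

Lemma lebesgue_rVS n (A : set 'rV[R]_n.+1) : lebesgue_rV n.+1 A =
  (@lebesgue_measure R \x lebesgue_rV n)%E (rV_cons @^-1` A).
Proof. by []. Qed.

Lemma lebesgue_rV_box n (A : 'I_n -> set R) :
  (forall i, measurable (A i)) ->
  lebesgue_rV n [set x | forall i, A i (x 0 i)] =
  (\prod_(i < n) @lebesgue_measure R (A i))%E.
Proof.
elim: n A => [|n IH] A mA.
  rewrite big_ord0 /= diracE mem_set//; by case.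
rewrite big_ord_recl.
have mbox : measurable [set x : 'rV[R]_n | forall i, A (lift ord0 i) (x 0 i)].
  rewrite (_ : [set _ | _] =
      \big[setI/setT]_(i < n) ((fun x : 'rV[R]_n => x 0 i) @^-1` A (lift ord0 i))).
    apply: bigsetI_measurable => i _.
    by rewrite -[X in measurable X]setTI; exact: measurable_coord.
  rewrite -bigcap_seq; apply/seteqP; split=> x /= h.
    by move=> i _; exact: h.
  by move=> i; apply: (h i); rewrite /= mem_index_enum.
rewrite -IH// -product_measure1E//; last exact: mA.
rewrite lebesgue_rVS; congr product_measure1.
apply/seteqP; split=> -[a x] /=.
  move=> h; split=> [|i]; first by have := h ord0; rewrite rV_cons0.
  by have := h (lift ord0 i); rewrite rV_consS.
by move=> [a0 xS] i; case: (unliftP ord0 i) => [j|] ->;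
  rewrite ?rV_cons0 ?rV_consS.
Qed.

End lebesgue_rV.

Section surface_measure.
Context {R : realType} {n : nat}.

Lemma measurable_edot (f g : 'rV[R]_n -> 'rV[R]_n) :
  measurable_fun setT f -> measurable_fun setT g ->
  measurable_fun setT (fun x => edot (f x) (g x)).
Proof.
move=> mf mg; apply: measurable_sum => i; apply: measurable_funM.
  by apply: (measurableT_comp (measurable_coord i)).
by apply: (measurableT_comp (measurable_coord i)).
Qed.

Lemma measurable_enorm : measurable_fun [set: 'rV[R]_n] (@enorm R n).
Proof.
apply: (@measurableT_comp _ _ _ _ _ _ (@Num.sqrt R)).
  by apply: continuous_measurable_fun; exact: sqrt_continuous.
exact: measurable_edot.
Qed.

Definition to_esphere (x : 'rV[R]_n) : 'rV[R]_n := (enorm x)^-1 *: x.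

Lemma measurable_to_esphere : measurable_fun setT to_esphere.
Proof.
apply: measurable_fun_rV => i; rewrite /to_esphere.
rewrite (_ : (fun _ => _) = fun x => enorm x `^ (-1) * x 0 i); last first.
  by apply/funext => x; rewrite mxE powR_inv1// sqrtr_ge0.
apply: measurable_funM; last exact: measurable_coord.
by apply: (@measurableT_comp _ _ _ _ _ _ (@powR R ^~ (-1))) => //;
  exact: measurable_enorm.
Qed.

Lemma measurable_unit_eball : measurable [set x : 'rV[R]_n | 0 < enorm x < 1].
Proof.
rewrite (_ : [set _ | _] = @enorm R n @^-1` `]0, 1[%classic).
  by rewrite -[X in measurable X]setTI; exact: measurable_enorm.
by apply/seteqP; split=> x /=; rewrite in_itv.
Qed.

(* Surface measure on the unit sphere, in polar coordinates:
   sigma(A) = n |{r s : 0 < r < 1, s in A}|. *)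
Definition surface_measure (A : set 'rV[R]_n) : \bar R :=
  (n%:R%:E * lebesgue_rV n
     ([set x | (0 < enorm x < 1)%R] `&` to_esphere @^-1` A))%E.

Let surface0 : surface_measure set0 = 0%E.
Proof. by rewrite /surface_measure preimage_set0 setI0 measure0 mule0. Qed.

Let surface_ge0 A : (0 <= surface_measure A)%E.
Proof. by apply: mule_ge0 => //; rewrite lee_fin. Qed.

Let surface_sigma_additive : semi_sigma_additive surface_measure.
Proof.
move=> F mF tF mUF; rewrite /surface_measure preimage_bigcup setI_bigcupr.
have mpre A : measurable A ->
    measurable ([set x | 0 < enorm x < 1] `&` to_esphere @^-1` A).
  move=> mA; apply: measurableI; first exact: measurable_unit_eball.
  by rewrite -[X in measurable X]setTI; exact: measurable_to_esphere.
have h : (fun m => \sum_(0 <= i < m) lebesgue_rV n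
      ([set x | (0 < enorm x < 1)%R] `&` to_esphere @^-1` F i))%E @ \oo -->
    lebesgue_rV n (\bigcup_i
      ([set x | (0 < enorm x < 1)%R] `&` to_esphere @^-1` F i)).
  apply: measure_semi_sigma_additive.
  - by move=> k; exact: mpre.
  - apply/trivIsetP => /= i j _ _ ij; rewrite setIACA setIid -preimage_setI.
    by move/trivIsetP : tF => /(_ _ _ _ _ ij) ->//; rewrite preimage_set0 setI0.
  - by rewrite -setI_bigcupr -preimage_bigcup; exact: mpre.
rewrite (_ : (fun m => _) = (fun m => n%:R%:E * \sum_(0 <= i < m) lebesgue_rV n
    ([set x | (0 < enorm x < 1)%R] `&` to_esphere @^-1` F i))%E); last first.
  by apply/funext => m; rewrite ge0_sume_distrr.
exact: cvgeZl.
Qed.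

HB.instance Definition _ := isMeasure.Build _ _ _ surface_measure
  surface0 surface_ge0 surface_sigma_additive.

End surface_measure.

Section domain.
Context {R : realType} {n : nat}.
Implicit Types Omega : set 'rV[R]_n.

(* Near each boundary point Omega is the strict epigraph, in the direction of a
   unit vector e, of a Lipschitz function of the orthogonal projection
   x - (x . e) e onto the hyperplane orthogonal to e. *)
Definition lipschitz_boundary Omega := forall x, (closure Omega `\` Omega°) x ->
  exists (e : 'rV[R]_n) (r L : R) (g : 'rV[R]_n -> R),
    [/\ enorm e = 1, 0 < r,
        forall y z, `|g y - g z| <= L * enorm (y - z) &
        Omega `&` eball x r =
        [set y | g (y - edot y e *: e) < edot y e] `&` eball x r].

Definition bounded_lipschitz_domain Omega :=
  [/\ Omega !=set0, open Omega, connected Omega,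
      exists M, forall x, Omega x -> enorm x <= M &
      lipschitz_boundary Omega].

Definition enlarge Omega (delta : R) : set 'rV[R]_n :=
  \bigcup_(x in Omega) eball x delta.

End domain.

Section Lp_on.
Context d (T : measurableType d) (R : realType).
Variables (mu : {measure set T -> \bar R}) (D : set T).

(* Elements of L^p(D) are represented by functions on T whose values outside D
   are irrelevant: they are replaced by 0. *)
Definition Lp_on (p : \bar R) : set (T -> R) :=
  [set f | f \_ D \in Lfun mu p].

Definition Lp_norm_on (p : \bar R) (f : T -> R) : \bar R :=
  'N[mu]_p[EFin \o (f \_ D)]%E.

Definition Linfty_pairing (k : T -> R) :
    {ptws {phi | Lp_on 1%E phi} -> R} :=
  fun phi => \int[mu]_(z in D) (k z * sval phi z).

(* The weak* topology is the coarsest one making k |-> \int_D k phi continuous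
   for each phi in L^1(D).  It does not separate a.e. equal representatives, so
   compactness here is compactness of the set of classes in L^oo(D). *)
Definition weak_star_compact (A : set (T -> R)) :=
  compact (A : set (initial_topology Linfty_pairing)).

End Lp_on.
Arguments Linfty_pairing {d T R} mu D k.

Section nonlocal.
Context {R : realType} {n : nat}.
Implicit Types (p q delta : R) (w : 'rV[R]_n -> R) (Omega : set 'rV[R]_n).

Local Notation X := 'rV[R]_n.
Local Notation mu := (lebesgue_rV n).
Local Notation mu2 := (lebesgue_rV n \x lebesgue_rV n)%E.

(* The constant K_{p,n}; its value does not depend on the unit vector e. *)
Definition Kpn p (e : X) : R :=
  (fine (surface_measure (@esphere R n)))^-1 *
  \int[surface_measure]_(s in @esphere R n) (`|edot e s| `^ p).

Definition nlkernel p (e : X) delta w :=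
  [/\ measurable_fun setT w,
      forall x, 0 <= w x,
      forall x y, enorm x = enorm y -> w x = w y,
      forall x, ~ eball 0 delta x -> w x = 0 &
      (\int[mu]_x (enorm x `^ p * w x `^ p)%R%:E = ((Kpn p e)^-1)%:E)%E].

Definition nlgrad w Omega (u : X -> R) (z : X * X) : R :=
  ((u \_ Omega) z.1 - (u \_ Omega) z.2) * w (z.1 - z.2).

Definition square Omega delta : set (X * X) :=
  enlarge Omega delta `*` enlarge Omega delta.

Definition Udelta0 p delta w Omega : set (X -> R) :=
  [set u | Lp_on mu Omega p%:E u /\
           Lp_on mu2 (square Omega delta) p%:E (nlgrad w Omega u)].

Definition nonlocal_poincare p delta w Omega (C : R) :=
  forall u, Udelta0 p delta w Omega u ->
    (Lp_norm_on mu Omega p%:E u <=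
     C%:E * Lp_norm_on mu2 (square Omega delta) p%:E (nlgrad w Omega u))%E.

(* The graph of the negative adjoint D_delta of nlgrad: sigma is in its domain
   and D_delta sigma = g.  As Udelta0 is dense in L^p(Omega), g is unique up to
   a.e. equality. *)
Definition is_nldiv p q delta w Omega (sigma : X * X -> R) (g : X -> R) :=
  [/\ Lp_on mu2 (square Omega delta) q%:E sigma,
      Lp_on mu Omega q%:E g &
      forall u, Udelta0 p delta w Omega u ->
        \int[mu]_(x in Omega) (g x * u x) =
        - \int[mu2]_(z in square Omega delta) (sigma z * nlgrad w Omega u z)].

Definition Qdelta p q delta w Omega (f : X -> R) : set (X * X -> R) :=
  [set sigma | is_nldiv p q delta w Omega sigma f].

Definition conductivities delta Omega (kmin kmax : R)
    (A : set (X * X -> R)) :=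
  [/\ A !=set0,
      A `<=` Lp_on mu2 (square Omega delta) +oo%E,
      @convex_set R (X * X -> R^o) A,
      weak_star_compact mu2 (square Omega delta) A &
      forall k, A k -> {ae mu2, forall z, square Omega delta z ->
        kmin <= k z <= kmax /\ k z = k (z.2, z.1)}].

Definition ihat p q delta w Omega (f : X -> R) (k : X * X -> R) : \bar R :=
  ereal_inf [set ((q^-1)%:E * \int[mu2]_(z in square Omega delta)
                    (k z `^ (1 - q) * `|sigma z| `^ q)%R%:E)%E
             | sigma in Qdelta p q delta w Omega f].

End nonlocal.

(* Main.v *)
Require Import Defs.
From mathcomp Require Import all_boot all_order all_algebra.
From mathcomp Require Import all_classical all_reals all_analysis.
From mathcomp Require Import measurable_realfun ring lra.
Set Implicit Arguments.
Unset Strict Implicit.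
Unset Printing Implicit Defensive.
Import Order.TTheory GRing.Theory Num.Theory.
Import numFieldNormedType.Exports.
Local Open Scope classical_set_scope.
Local Open Scope ring_scope.

(** By duality [ihat k] is the maximum over [u] in [Udelta0] of
    [dual_energy u k = - (1/p) \int k |G u|^p - \int f u]. Weak duality is Young's
    inequality. For equality, minimise
    [(1/p) \int k |G u|^p + \int f u]: by the Poincare inequality it is coercive,
    by uniform convexity of [|.|^p] minimising sequences are Cauchy, and by Fatou's
    lemma their limit is a minimiser [u]; its Euler-Lagrange equation says that
    [k |G u|^(p-2) G u] lies in [Qdelta f], where Young's inequality is an equality.
    Each [dual_energy u] is affine and weak* continuous in [k], since [|G u|^p] is in
    L^1. Hence [ihat] is weak* lower semicontinuous and attains its infimum on the
    weak* compact set [A]. *)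

(** * Inequalities for real powers *)

(** The cost is nonlinear in [kappa], so weak* convergence of conductivities gives no limit for
    [kappa^(1-q)]; in the dual form [kappa] enters linearly, paired with a fixed L^1 function. The
    Euler-Lagrange equation also produces an admissible flux, so [Qdelta f] is never empty.

    The minimiser is found without weak compactness in L^p. Uniform convexity turns a small energy
    gap into a small L^p distance, so a minimising sequence chosen fast enough converges almost
    everywhere. The gradient is a pointwise difference of values, hence it converges almost
    everywhere along with the sequence, and Fatou's lemma carries the energy bound to the limit.

    Functions here are genuine functions, not classes. This shapes several constructions: limits are
    set to 0 on null sets, competitors are normalised to vanish off [Omega], and conductivities,
    bounded only almost everywhere on the square, are clamped. *)

Section signed_power.
Context {R : realType}.
Implicit Types r s x y : R.

(** For [r != 0] this is sgn(x) |x|^r, so [spow (p - 1) x] is |x|^(p-2) x. The split into positive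
    and negative parts makes oddness immediate and reduces continuity at 0 to that of a one-sided
    power. *)
Definition spow r x : R := Num.max x 0 `^ r - Num.max (- x) 0 `^ r.

Lemma continuous_maxr0_powR r : 0 < r ->
  continuous (fun x : R => Num.max x 0 `^ r).
Proof.
move=> r0.
have cpow (x : R) : 0 < x -> {for x, continuous (fun y : R => y `^ r)}.
  move=> x0; apply: differentiable_continuous; apply/derivable1_diffP.
  by apply: derivable_powR; rewrite in_itv/= x0.
move=> x; have [x0|x0|->] := ltgtP x 0.
- apply: cvg_near_cst; near=> y.
  have y0 : y < 0 by near: y; exact: lt_nbhsl.
  by rewrite !max_r// ltW.
- rewrite /continuous_at max_l ?ltW//; apply: cvg_trans (cpow x x0).
  apply: near_eq_cvg; near=> y.
  have y0 : 0 < y by near: y; exact: lt_nbhsr.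
  by rewrite max_l// ltW.
- rewrite /continuous_at maxxx powR0 ?gt_eqF//; apply/cvgrPdist_lt => e e0.
  near=> y; rewrite sub0r normrN ger0_norm ?powR_ge0//.
  (* Writing e as (e^(1/r))^r turns the claim into a bound on the base, by monotonicity of the
     power. *)
  rewrite -[e]powRr1 ?ltW// -(@mulVf _ r) ?gt_eqF// powRrM.
  apply: gt0_ltr_powR => //; rewrite ?nnegrE ?powR_ge0// ?le_max ?lexx ?orbT//.
  rewrite gt_max powR_gt0// andbT.
  by near: y; apply: lt_nbhsl; exact: powR_gt0.
Unshelve. all: end_near. Qed.

Lemma continuous_spow r : 0 < r -> continuous (spow r).
Proof.
move=> r0 x; apply: cvgB; first exact: continuous_maxr0_powR.
apply: (@continuous_comp _ _ _ (fun y : R => - y) (fun y => Num.max y 0 `^ r)).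
  exact: opp_continuous.
exact: continuous_maxr0_powR.
Qed.

Lemma normr_powRE r x : r != 0 ->
  `|x| `^ r = Num.max x 0 `^ r + Num.max (- x) 0 `^ r.
Proof.
move=> r0; have [x0|x0] := leP 0 x.
  by rewrite ger0_norm// max_r ?oppr_le0// powR0// addr0.
by rewrite ltr0_norm// max_l ?oppr_ge0 ?ltW// powR0// add0r.
Qed.

Lemma continuous_normr_powR r : 0 < r -> continuous (fun x : R => `|x| `^ r).
Proof.
move=> r0; rewrite (_ : (fun _ => _) =
    (fun x => Num.max x 0 `^ r + Num.max (- x) 0 `^ r)); last first.
  by apply/funext => x; rewrite normr_powRE ?gt_eqF.
move=> x; apply: cvgD; first exact: continuous_maxr0_powR.
apply: (@continuous_comp _ _ _ (fun y : R => - y) (fun y => Num.max y 0 `^ r)).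
  exact: opp_continuous.
exact: continuous_maxr0_powR.
Qed.

Lemma spow_ge0E r x : r != 0 -> 0 <= x -> spow r x = x `^ r.
Proof.
by move=> r0 x0; rewrite /spow max_l// max_r ?oppr_le0// powR0// subr0.
Qed.

Lemma spowN r x : spow r (- x) = - spow r x.
Proof. by rewrite /spow opprK opprB. Qed.

Lemma normr_spow r x : r != 0 -> `|spow r x| = `|x| `^ r.
Proof.
move=> r0; wlog x0 : x / 0 <= x => [h|].
  by have [/h//|/ltW] := leP 0 x; rewrite -oppr_ge0 => /h; rewrite spowN !normrN.
by rewrite spow_ge0E// !ger0_norm// powR_ge0.
Qed.

Lemma spowM x r : 1 < r -> spow (r - 1) x * x = `|x| `^ r.
Proof.
move=> r1; have r0 : r - 1 != 0 by rewrite gt_eqF// subr_gt0.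
wlog x0 : x / 0 <= x => [h|].
  have [/h//|/ltW] := leP 0 x; rewrite -oppr_ge0 => /h.
  by rewrite spowN normrN mulrNN.
by rewrite spow_ge0E// ger0_norm// mulrC mulr_powRB1// (lt_trans ltr01).
Qed.

Lemma ltr_spow r : 0 < r -> {homo spow r : x y / x < y}.
Proof.
move=> r0; have rN0 : r != 0 by rewrite gt_eqF.
have pos x y : 0 <= x -> x < y -> spow r x < spow r y.
  move=> x0 xy; have y0 : 0 <= y by rewrite (le_trans x0)// ltW.
  by rewrite !spow_ge0E//; apply: gt0_ltr_powR.
move=> x y xy; have [x0|x0] := leP 0 x; first exact: pos.
have sx0 : spow r x < 0.
  rewrite -oppr_gt0 -spowN spow_ge0E ?oppr_ge0 ?ltW//.
  by rewrite powR_gt0// oppr_gt0.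
have [y0|y0] := leP 0 y.
  by rewrite (lt_le_trans sx0)// spow_ge0E// powR_ge0.
rewrite -[x]opprK -[y]opprK spowN (spowN _ (- y)) ltrN2.
by apply: pos; rewrite ?oppr_ge0 ?ltrN2// ltW.
Qed.

End signed_power.

Section power_inequalities.
Context {R : realType}.
Variables p q : R.
Hypotheses (p1 : 1 < p) (pq : p^-1 + q^-1 = 1).
Implicit Types a b s x y : R.

Let p0 : 0 < p. Proof. exact: lt_trans ltr01 p1. Qed.

Lemma conjugate_gt1r : 1 < q.
Proof.
have qV : q^-1 = 1 - p^-1 by rewrite -pq addrAC subrr add0r.
have qV0 : 0 < q^-1 by rewrite qV subr_gt0 invf_lt1.
have q0 : 0 < q by rewrite -invr_gt0.
by rewrite -[q]invrK invf_gt1// qV gtrBl invr_gt0.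
Qed.
Let q1 := conjugate_gt1r.
Let q0 : 0 < q. Proof. exact: lt_trans ltr01 q1. Qed.

Lemma conjugateB1M : (p - 1) * q = p.
Proof.
have pqE : p * q * (p^-1 + q^-1) = p + q by field; rewrite !gt_eqF.
move: pqE; rewrite pq mulr1 => pqE.
by rewrite mulrBl mul1r pqE addrK.
Qed.

(** Young's inequality for [s * a] and [b / s], with the factors 1/p and 1/q bounded by 1. The free
    weight [s] is what later allows one of the two terms to be made small. *)
Lemma young_normr s a b : 0 < s ->
  `|a * b| <= s `^ p * `|a| `^ p + s `^ (- q) * `|b| `^ q.
Proof.
move=> s0.
have -> : `|a * b| = (s * `|a|) * (s^-1 * `|b|).
  by rewrite normrM mulrACA mulfV ?gt_eqF// mul1r.
have sa0 : 0 <= s * `|a| by rewrite mulr_ge0// ltW.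
have sb0 : 0 <= s^-1 * `|b| by rewrite mulr_ge0// invr_ge0 ltW.
apply: (le_trans (conjugate_powR _ _ p0 q0 pq)) => //.
rewrite powRM ?(ltW s0)// powRM ?invr_ge0 ?(ltW s0)//.
rewrite -powR_inv1 ?(ltW s0)// -powRrM mulN1r.
by apply: lerD; rewrite ler_piMr ?mulr_ge0 ?powR_ge0// invf_le1// ltW.
Qed.

(* Young's inequality for the pair [spow (p-1) x], [y] is the convexity of
   [|x|^p / p], whose derivative is [spow (p-1)]. *)
Lemma normr_powR_tangent x y :
  p^-1 * `|x| `^ p + spow (p - 1) x * (y - x) <= p^-1 * `|y| `^ p.
Proof.
have pB0 : p - 1 != 0 by rewrite gt_eqF// subr_gt0.
rewrite mulrBr spowM//.
have : spow (p - 1) x * y <= q^-1 * `|x| `^ p + p^-1 * `|y| `^ p.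
  rewrite (le_trans (ler_norm _))// normrM normr_spow//.
  rewrite mulrC (le_trans (conjugate_powR _ _ p0 q0 pq))//.
  by rewrite -powRrM conjugateB1M addrC ![_^-1 * _]mulrC.
have -> : q^-1 = 1 - p^-1 by rewrite -pq addrAC subrr add0r.
by lra.
Qed.

(** The tangent inequality alone is not strict. Strictness comes from a second tangent point [b']
    between the midpoint [m] and [b]: the slope [spow (p - 1)] strictly increases from [m] to [b'].
    All increments are multiples of [(b - a) / 4], so that the three tangent inequalities add up. *)
Lemma midpoint_normr_powR_lt a b : a != b ->
  `|(a + b) / 2| `^ p < (`|a| `^ p + `|b| `^ p) / 2.
Proof.
wlog ab : a b / a < b => [h|_].
  case: (ltgtP a b) => // ab _; first by rewrite h// lt_eqF.
  by rewrite (addrC a) (addrC (`|a| `^ p)) h// lt_eqF.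
pose m := (a + b) / 2; pose b' := (m + b) / 2.
have Hb := normr_powR_tangent b' b.
have Hm := normr_powR_tangent m b'.
have Ha := normr_powR_tangent m a.
have lt1 : spow (p - 1) m < spow (p - 1) b'.
  by apply: ltr_spow; rewrite ?subr_gt0// /b' /m; lra.
have mbE : b' - m = (b - a) / 4 by rewrite /b' /m; field.
have bbE : b - b' = (b - a) / 4 by rewrite /b' /m; field.
have maE : a - m = - ((b - a) / 4) - (b - a) / 4 by rewrite /m; field.
rewrite mbE in Hm; rewrite bbE in Hb; rewrite maE in Ha.
have ab4 : 0 < (b - a) / 4 by rewrite divr_gt0// subr_gt0.
have lt2 : spow (p - 1) m * ((b - a) / 4) < spow (p - 1) b' * ((b - a) / 4).
  by rewrite ltr_pM2r.
have : p^-1 * (`|m| `^ p *+ 2) < p^-1 * (`|a| `^ p + `|b| `^ p).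
  by rewrite mulrnAr mulrDr mulr2n; nra.
rewrite ltr_pM2l ?invr_gt0// => H.
by rewrite -/m ltr_pdivlMr// mulr_natr.
Qed.

Lemma midpoint_normr_powR a b :
  `|(a + b) / 2| `^ p <= (`|a| `^ p + `|b| `^ p) / 2.
Proof.
have [->|/midpoint_normr_powR_lt/ltW//] := eqVneq a b.
by have E (x : R) : (x + x) / 2 = x; [field | rewrite !E].
Qed.

Lemma normrD_powR a b : `|a + b| `^ p <= 2 `^ p * (`|a| `^ p + `|b| `^ p).
Proof.
have -> : a + b = 2 * ((a + b) / 2) by field.
rewrite normrM powRM// ger0_norm// ler_pM2l ?powR_gt0//.
rewrite (le_trans (midpoint_normr_powR _ _))// ler_pdivrMr//.
by rewrite ler_peMr ?addr_ge0 ?powR_ge0// ler1n.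
Qed.

(* By homogeneity the inequality reduces to [a = 1], [-1 <= b <= 1], where it
   follows by compactness from the strict convexity of [|x|^p]. *)
Lemma uniform_convexity_normr_powR (e : R) : 0 < e -> exists2 c, 0 <= c &
  forall a b, `|a - b| `^ p <= e * (`|a| `^ p + `|b| `^ p) +
    c * ((`|a| `^ p + `|b| `^ p) / 2 - `|(a + b) / 2| `^ p).
Proof.
move=> e0; pose h s := (1 + `|s| `^ p) / 2 - `|(1 + s) / 2| `^ p.
have h0 s : 0 <= h s.
  by rewrite subr_ge0; have := midpoint_normr_powR 1 s; rewrite normr1 powR1.
have hgt0 s : s != 1 -> 0 < h s.
  rewrite subr_gt0 eq_sym => /midpoint_normr_powR_lt.
  by rewrite normr1 powR1.
(* Within distance [t] of 1 the term with [e] suffices, since [t] to the power [p] is at most [e].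
   On the compact rest [-1, 1 - t] the convexity gap [h] has a positive minimum [h s0], and |1 -
   s|^p is at most 2^p, whence the constant [c] below. *)
pose t := Num.min 1 (e `^ p^-1).
have t01 : 0 < t <= 1 by rewrite lt_min ltr01 powR_gt0//= ge_min lexx.
have [t0 t1] := andP t01.
have ch : continuous h.
  move=> s; apply: cvgB.
    apply: cvgM; last exact: cvg_cst.
    by apply: cvgD; [exact: cvg_cst|exact: continuous_normr_powR].
  apply: (@continuous_comp _ _ _ (fun s => (1 + s) / 2) (fun x => `|x| `^ p)).
    by apply: cvgM; [apply: cvgD; [exact: cvg_cst|]|exact: cvg_cst].
  exact: continuous_normr_powR.
have N1t : -1 <= 1 - t by lra.
have /(EVT_min N1t)[s0 /[!in_itv]/= /andP[_ s0t] s0min] :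
    {within `[-1, 1 - t], continuous h}.
  exact: continuous_subspaceT.
have hs0 : 0 < h s0 by rewrite hgt0// lt_eqF// (le_lt_trans s0t)// gtrBl.
pose c := 2 `^ p / h s0.
have c0 : 0 <= c by rewrite divr_ge0 ?powR_ge0// ltW.
have key s : -1 <= s <= 1 -> `|1 - s| `^ p <= e * (1 + `|s| `^ p) + c * h s.
  move=> /andP[s1 s2]; have [st|st] := leP s (1 - t).
    rewrite -[leLHS]add0r lerD ?mulr_ge0 ?addr_ge0 ?powR_ge0 ?(ltW e0)//.
    apply: (@le_trans _ _ (2 `^ p)).
      apply: ge0_ler_powR; rewrite ?nnegrE ?(ltW p0)//.
      by rewrite ler_norml; apply/andP; split; lra.
    rewrite /c mulrAC -mulrA ler_peMr ?powR_ge0//.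
    by rewrite ler_pdivlMr// mul1r s0min// in_itv/= s1.
  rewrite -[leLHS]addr0 lerD ?mulr_ge0//.
  apply: (@le_trans _ _ e); last by rewrite ler_peMr ?(ltW e0)// lerDl powR_ge0.
  have -> : e = (e `^ p^-1) `^ p by rewrite -powRrM mulVf ?gt_eqF// powRr1// ltW.
  apply: ge0_ler_powR; rewrite ?nnegrE ?powR_ge0 ?(ltW p0)//.
  have te : t <= e `^ p^-1 by rewrite ge_min lexx orbT.
  by rewrite ger0_norm; lra.
  by rewrite invr_ge0 ltW.
exists c => [//|a b]; wlog ba : a b / `|b| <= `|a| => [H|].
  have [/H//|/ltW/H] := leP `|b| `|a|.
  by rewrite distrC [a + b]addrC [`|a| `^ p + _]addrC.
have [a0|a0] := eqVneq a 0.
  move: ba; rewrite a0 normr0 normr_le0 => /eqP ->.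
  by rewrite subr0 addr0 mul0r normr0 powR0 ?gt_eqF// addr0 mul0r subr0 !mulr0 addr0.
pose s := b / a; have bE : b = a * s by rewrite mulrC divfK.
have s1 : -1 <= s <= 1.
  by rewrite -ler_norml normrM normfV ler_pdivrMr ?normr_gt0// mul1r.
have := ler_wpM2l (powR_ge0 `|a| p) (key s s1); clearbody s.
have -> : a - b = a * (1 - s) by rewrite bE mulrBr mulr1.
have -> : (a + b) / 2 = a * ((1 + s) / 2) by rewrite bE; field.
rewrite !normrM !powRM// bE normrM powRM// => /le_trans; apply.
rewrite /h normrM !powRM//.
by rewrite le_eqVlt; apply/orP; left; apply/eqP; field.
Qed.

End power_inequalities.

(** * Integrals of powers *)

Section real_integral.
Context d (T : measurableType d) (R : realType).
Variable mu : {measure set T -> \bar R}.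
Implicit Types f g h : T -> R.

Lemma integrable_measurable f :
  mu.-integrable setT (EFin \o f) -> measurable_fun setT f.
Proof. by move=> /measurable_int /measurable_EFinP. Qed.

Lemma le_integrable_normr f h : measurable_fun setT f ->
  (forall x, `|f x| <= h x) -> mu.-integrable setT (EFin \o h) ->
  mu.-integrable setT (EFin \o f).
Proof.
move=> mf fh ih; apply: le_integrable ih => //; first exact/measurable_EFinP.
by move=> x _ /=; rewrite lee_fin (le_trans (fh x))// ler_norm.
Qed.

Lemma integrableD_EFin f g : mu.-integrable setT (EFin \o f) ->
  mu.-integrable setT (EFin \o g) ->
  mu.-integrable setT (EFin \o (fun x => f x + g x)).
Proof. by move=> /integrableD h /h; exact. Qed.

Lemma integrableB_EFin f g : mu.-integrable setT (EFin \o f) ->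
  mu.-integrable setT (EFin \o g) ->
  mu.-integrable setT (EFin \o (fun x => f x - g x)).
Proof. by move=> fi gi; exact: (integrableB measurableT fi gi). Qed.

Lemma integrableZl_EFin (r : R) f : mu.-integrable setT (EFin \o f) ->
  mu.-integrable setT (EFin \o (fun x => r * f x)).
Proof. by move=> /integrableZl; exact. Qed.

Lemma EFin_Rintegral f : mu.-integrable setT (EFin \o f) ->
  (\int[mu]_x f x)%:E = (\int[mu]_x (f x)%:E)%E.
Proof. by move=> fi; rewrite fineK//; exact: integrable_fin_num. Qed.

Lemma ae_eq_Rintegral f g : measurable_fun setT f -> measurable_fun setT g ->
  {ae mu, forall x, f x = g x} -> \int[mu]_x f x = \int[mu]_x g x.
Proof.
move=> mf mg fg; congr fine; apply: ae_eq_integral => //.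
- exact/measurable_EFinP.
- exact/measurable_EFinP.
- by apply: filterS fg => x fgx _; rewrite fgx.
Qed.

Lemma ae_eq_integrable f g : measurable_fun setT g ->
  {ae mu, forall x, f x = g x} ->
  mu.-integrable setT (EFin \o f) -> mu.-integrable setT (EFin \o g).
Proof.
move=> mg fg fi; have mf := integrable_measurable fi.
move/integrableP : fi => [_ fi]; apply/integrableP; split.
  exact/measurable_EFinP.
rewrite (le_lt_trans _ fi)//; apply: ae_ge0_le_integral => //.
- by do 2 apply: measurableT_comp => //.
- by do 2 apply: measurableT_comp => //.
- by apply: filterS fg => x fgx _ /=; rewrite fgx.
Qed.

(** Fatou's lemma is applied off the null set where convergence may fail; there the lower limit is
    [h] itself. Since [h] is nonnegative, the bound on its integral also gives integrability. *)
Lemma fatou_ae (h_ : nat -> T -> R) h (M : R) :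
  (forall k, measurable_fun setT (h_ k)) -> measurable_fun setT h ->
  (forall k x, 0 <= h_ k x) -> (forall x, 0 <= h x) ->
  {ae mu, forall x, h_ ^~ x @ \oo --> h x} ->
  (forall k, \int[mu]_x (h_ k x)%:E <= M%:E)%E ->
  mu.-integrable setT (EFin \o h) /\ \int[mu]_x h x <= M.
Proof.
move=> mh_ mh h_0 h0 hh hM.
have H : (\int[mu]_x (h x)%:E <= M%:E)%E.
  have [N [mN N0 subN]] := hh.
  have mE g : measurable_fun setT g -> measurable_fun (~` N) (EFin \o g).
    by move=> mg; apply: measurable_funTS; exact/measurable_EFinP.
  have negl (g : T -> R) : measurable_fun setT g -> (forall x, 0 <= g x) ->
      (\int[mu]_x (g x)%:E = \int[mu]_(x in ~` N) (g x)%:E)%E.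
    move=> mg g0; rewrite (ge0_negligible_integral mN)// ?setTD//.
    - exact/measurable_EFinP.
    - by move=> x _; rewrite lee_fin.
  rewrite negl//; have := @fatou _ _ _ mu (~` N) (measurableC mN)
    (fun k x => (h_ k x)%:E) (fun k => mE _ (mh_ k)).
  move=> /(_ (fun k x _ => h_0 k x)) F.
  rewrite (_ : (\int[mu]_(x in ~` N) (h x)%:E =
      \int[mu]_(x in ~` N) limn_einf (fun k => (h_ k x)%:E))%E); last first.
    apply: eq_integral => x /[!inE] Nx.
    have hx : h_ ^~ x @ \oo --> h x.
      by apply: contrapT => hx; apply: Nx; exact: subN.
    have /cvg_limn_einf_sup[->//] : (h_ k x)%:E @[k --> \oo] --> (h x)%:E.
    by apply: cvg_EFin => //; exact: nearW.
  apply: (le_trans F); rewrite limn_einf_lim; apply: lime_le.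
    exact: is_cvg_einfs.
  apply: nearW => k; apply: (@le_trans _ _ (\int[mu]_(x in ~` N) (h_ k x)%:E)%E).
    by apply: ereal_inf_lbound; exists k => /=.
  by rewrite -negl.
have hi : mu.-integrable setT (EFin \o h).
  apply/integrableP; split; first exact/measurable_EFinP.
  rewrite (le_lt_trans _ (ltry M))// (le_trans _ H)//.
  by under eq_integral do rewrite /= ger0_norm//.
by split => //; rewrite -lee_fin EFin_Rintegral.
Qed.

End real_integral.

Section pintegrable.
Context d (T : measurableType d) (R : realType).
Variable mu : {measure set T -> \bar R}.
Implicit Types (f g : T -> R) (p q : R).

Definition pintegrable p g := measurable_fun setT g /\
  mu.-integrable setT (EFin \o (fun x => `|g x| `^ p)).

Lemma measurable_normr_powR p g : measurable_fun setT g ->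
  measurable_fun setT (fun x => `|g x| `^ p).
Proof.
move=> mg; apply: (measurableT_comp (measurable_powR _)) => //.
exact: measurableT_comp.
Qed.

Lemma Lfun_pintegrable p g : 1 <= p ->
  g \in Lfun mu p%:E <-> pintegrable p g.
Proof.
move=> p1; split=> [gL|[mg gi]].
  split; last exact: Lfun_integrable.
  by move: gL; rewrite inE => /andP[/[!inE]].
rewrite inE; apply/andP; split; rewrite inE//=.
rewrite /finite_norm unlock /=; apply: poweR_lty.
move/integrableP : gi => [_]; apply: le_lt_trans; rewrite le_eqVlt.
apply/orP; left; apply/eqP; apply: eq_integral => x _.
by rewrite /= [in RHS]ger0_norm ?powR_ge0.
Qed.

Lemma pintegrableZ p c g : pintegrable p g -> pintegrable p (fun x => c * g x).
Proof.
move=> [mg gi]; split; first exact: measurable_funM.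
under [X in EFin \o X]eq_fun do rewrite normrM powRM//.
exact: integrableZl_EFin.
Qed.

Lemma pintegrableD p q f g : 1 < p -> p^-1 + q^-1 = 1 ->
  pintegrable p f -> pintegrable p g -> pintegrable p (fun x => f x + g x).
Proof.
move=> p1 pq [mf fi] [mg gi].
have mfg : measurable_fun setT (fun x => f x + g x) by exact: measurable_funD.
split => //; apply: (@le_integrable_normr _ _ _ _ _
    (fun x => 2 `^ p * (`|f x| `^ p + `|g x| `^ p))).
- exact: measurable_normr_powR.
- move=> x; rewrite ger0_norm ?powR_ge0//; exact: normrD_powR p1 pq _ _.
- by apply: integrableZl_EFin; exact: integrableD_EFin.
Qed.

Lemma pintegrableB p q f g : 1 < p -> p^-1 + q^-1 = 1 ->
  pintegrable p f -> pintegrable p g -> pintegrable p (fun x => f x - g x).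
Proof.
move=> p1 pq fi gi; under eq_fun do rewrite -mulN1r.
by apply: (pintegrableD p1 pq) => //; exact: pintegrableZ.
Qed.

Lemma pintegrable_integrableM p q f g : 1 < p -> p^-1 + q^-1 = 1 ->
  pintegrable q f -> pintegrable p g ->
  mu.-integrable setT (EFin \o (fun x => f x * g x)).
Proof.
move=> p1 pq [mf fi] [mg gi]; apply: (@le_integrable_normr _ _ _ _ _
    (fun x => `|g x| `^ p + `|f x| `^ q)); last exact: integrableD_EFin.
- exact: measurable_funM.
- move=> x; have := @young_normr _ p q p1 pq 1 (g x) (f x) ltr01.
  by rewrite !powR1 !mul1r mulrC.
Qed.

(** An additive substitute for Hölder's inequality: a small [s] puts a small factor on the integral
    of |g|^p, a large [s] on that of |f|^q. *)
Lemma normr_Rintegral_young p q f g s : 1 < p -> p^-1 + q^-1 = 1 -> 0 < s ->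
  pintegrable q f -> pintegrable p g ->
  `|\int[mu]_x (f x * g x)| <= s `^ p * \int[mu]_x (`|g x| `^ p) +
    s `^ (- q) * \int[mu]_x (`|f x| `^ q).
Proof.
move=> p1 pq s0 fi gi; have fgi := pintegrable_integrableM p1 pq fi gi.
apply: (le_trans (le_normr_Rintegral _ _)) => //.
rewrite -!RintegralZl ?gi.2 ?fi.2// -RintegralD//; last 2 first.
  by apply: integrableZl_EFin; exact: gi.2.
  by apply: integrableZl_EFin; exact: fi.2.
apply: le_Rintegral => //.
- exact: integrable_norm.
- apply: integrableD_EFin; apply: integrableZl_EFin; [exact: gi.2|exact: fi.2].
- by move=> x _; rewrite mulrC; exact: young_normr.
Qed.

(* [sum_j 2^(jp) |u_(j+1) - u_j|^p] has finite integral, so that almost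
   everywhere its terms are bounded and [|u_(j+1) - u_j| <= M 2^(-j)]. *)
Lemma pintegrable_fast_cauchy p (u : nat -> T -> R) : 1 < p ->
  (forall j, measurable_fun setT (u j)) ->
  (forall j, mu.-integrable setT (EFin \o (fun x => `|u j.+1 x - u j x| `^ p))) ->
  (forall j, \int[mu]_x (`|u j.+1 x - u j x| `^ p) <=
    2^-1 ^+ j * (2^-1 ^+ j) `^ p) ->
  {ae mu, forall x, cvgn (u ^~ x)}.
Proof.
move=> p1 mu_ iu uM.
pose g x := (\sum_(j <oo) ((2 ^+ j) `^ p * `|u j.+1 x - u j x| `^ p)%:E)%E.
have md j : measurable_fun setT
    (fun x => (2 ^+ j) `^ p * `|u j.+1 x - u j x| `^ p).
  apply: measurable_funM => //; apply: measurable_normr_powR.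
  exact: measurable_funB.
have d0 j x : (0 <= ((2 ^+ j) `^ p * `|u j.+1 x - u j x| `^ p)%:E)%E.
  by rewrite lee_fin mulr_ge0 ?powR_ge0.
have gE : (\int[mu]_x g x <= 2%:E)%E.
  rewrite integral_nneseries//; last first.
    by move=> j; exact/measurable_EFinP.
  (* The j-th integral is at most 2^-j, read as 2 / 2^(j+1) to match the summable series of
     [epsilon_trick0]. *)
  apply: le_trans (@epsilon_trick0 R 2 xpredT _) => //.
  apply: lee_nneseries => j _; first by move=> _; exact: integral_ge0.
  rewrite -EFin_Rintegral; last exact: integrableZl_EFin.
  rewrite RintegralZl// lee_fin.
  apply: (@le_trans _ _ ((2 ^+ j) `^ p * (2^-1 ^+ j * (2^-1 ^+ j) `^ p))).
    by rewrite ler_wpM2l ?powR_ge0.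
  rewrite mulrCA -powRM ?exprn_ge0// -exprMn mulfV// expr1n powR1 mulr1.
  by rewrite natrX exprS invfM mulrA mulfV// mul1r exprVn.
have mg : measurable_fun setT g.
  rewrite /g; apply: (@ge0_emeasurable_sum _ _ _ setT _ xpredT) => // j _.
  exact/measurable_EFinP.
have gi : mu.-integrable setT g.
  apply/integrableP; split => //; apply: (@le_lt_trans _ _ 2%:E); last exact: ltry.
  apply: le_trans gE; rewrite le_eqVlt; apply/orP; left; apply/eqP.
  by apply: eq_integral => x _; rewrite gee0_abs//; exact: nneseries_ge0.
have := integrable_ae measurableT gi; apply: filterS => x /(_ I) gx.
pose M := (fine (g x)) `^ p^-1.
have p0 : 0 < p by exact: lt_trans p1.
have dM j : `|u j.+1 x - u j x| <= M * 2^-1 ^+ j.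
  have : (((2 ^+ j) `^ p * `|u j.+1 x - u j x| `^ p)%:E <= (fine (g x))%:E)%E.
    rewrite fineK//.
    apply: le_trans (@nneseries_lim_ge _ (fun j => _) xpredT 0%N j.+1 _) => //.
    by rewrite big_nat_recr//= leeDr// sume_ge0.
  rewrite lee_fin -powRM ?exprn_ge0// => H.
  have : ((2 ^+ j * `|u j.+1 x - u j x|) `^ p) `^ p^-1 <= M.
    by apply: ge0_ler_powR; rewrite ?nnegrE ?powR_ge0 ?invr_ge0 ?(ltW p0)//;
      rewrite (le_trans _ H) ?powR_ge0.
  rewrite -powRrM mulfV ?gt_eqF// powRr1 ?mulr_ge0 ?exprn_ge0//.
  by rewrite exprVn ler_pdivlMr ?exprn_gt0// mulrC.
rewrite (_ : u ^~ x = (fun n => u 0%N x + series (telescope (u ^~ x)) n)); last first.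
  by apply/funext => n; exact: eq_sum_telescope.
apply: is_cvgD; first exact: is_cvg_cst.
apply: normed_cvg; apply: (@series_le_cvg _ _ (geometric M (2^-1))) => //.
- by move=> n; exact: normr_ge0.
- by move=> n; rewrite /= mulr_ge0 ?powR_ge0 ?exprn_ge0.
- apply: is_cvg_geometric_series; rewrite ger0_norm//.
  by rewrite invf_lt1// ltr1n.
Qed.

End pintegrable.

Section fast_cauchy_lim.
Context d (T : measurableType d) (R : realType).
Variable mu : {measure set T -> \bar R}.

(** Completeness of L^p with an explicit rate: at fixed [j] the Cauchy bound passes to the limit in
    [k] by Fatou's lemma. Integrability of the limit then follows by writing it as [v - u 0] plus
    [u 0]. *)
Lemma pintegrable_fast_cauchy_lim (p q : R) (u : nat -> T -> R) :
  1 < p -> p^-1 + q^-1 = 1 ->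
  (forall j, pintegrable mu p (u j)) ->
  (forall j k, (j <= k)%N -> \int[mu]_x (`|u k x - u j x| `^ p) <=
    2^-1 ^+ j * (2^-1 ^+ j) `^ p) ->
  exists v, [/\ pintegrable mu p v, {ae mu, forall x, u ^~ x @ \oo --> v x} &
    forall j, \int[mu]_x (`|v x - u j x| `^ p) <= 2^-1 ^+ j * (2^-1 ^+ j) `^ p].
Proof.
move=> p1 pq ui uM.
have p0 : 0 < p by exact: lt_trans p1.
have uBi j k : pintegrable mu p (fun x => u k x - u j x).
  exact: (pintegrableB p1 pq).
have [N [mN N0 subN]] : {ae mu, forall x, cvgn (u ^~ x)}.
  apply: (@pintegrable_fast_cauchy _ _ _ mu p) => // j.
  - by have [] := ui j.
  - by have [] := uBi j j.+1.
  - exact: uM.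
(* The value 0 on [N] makes [v] an everywhere limit of the measurable functions [u j] cut off to the
   complement of [N], hence measurable. *)
pose v x := if x \in N then 0 else lim (u ^~ x @ \oo).
have uv : {ae mu, forall x, u ^~ x @ \oo --> v x}.
  exists N; split => // x /= ux; apply: contrapT => xN; apply: ux.
  rewrite /v memNset//; apply: contrapT => h; apply: xN; apply: subN => /= cux.
  exact: h.
have mv : measurable_fun setT v.
  apply: (@measurable_fun_cvg _ _ _ _ (fun j => (u j) \_ (~` N))).
    move=> j; apply/(measurable_restrictT _ (measurableC mN)).
    by apply: measurable_funTS; have [] := ui j.
  move=> x _; rewrite /v; case: ifPn => xN.
    rewrite (_ : (fun _ => _) = fun=> 0); first exact: cvg_cst.
    by apply/funext => j; rewrite patchE in_setC xN.
  rewrite (_ : (fun _ => _) = u ^~ x); last first.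
    by apply/funext => j; rewrite patchE in_setC xN.
  apply: contrapT => h; move: xN; rewrite notin_setE; apply; apply: subN => /= cux.
  exact: h.
have vM j : mu.-integrable setT (EFin \o (fun x => `|v x - u j x| `^ p)) /\
    \int[mu]_x (`|v x - u j x| `^ p) <= 2^-1 ^+ j * (2^-1 ^+ j) `^ p.
  apply: (@fatou_ae _ _ _ _ (fun k x => `|u (k + j)%N x - u j x| `^ p)).
  - by move=> k; apply: measurable_normr_powR; have [] := uBi j (k + j)%N.
  - by apply: measurable_normr_powR; apply: measurable_funB => //; have [] := ui j.
  - by move=> *; exact: powR_ge0.
  - by move=> *; exact: powR_ge0.
  - apply: filterS uv => x uvx.
    apply: (@cvg_comp _ _ _ (fun k => u (k + j)%N x - u j x)
      (fun y => `|y| `^ p) _ (nbhs (v x - u j x))); last exact: continuous_normr_powR.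
    apply: cvgB; last exact: cvg_cst.
    by move: uvx; rewrite -(cvg_shiftn j).
  - move=> k; rewrite -EFin_Rintegral ?lee_fin; last by have [] := uBi j (k + j)%N.
    by rewrite uM// leq_addl.
exists v; split => //; last by move=> j; have [] := vM j.
rewrite (_ : v = fun x => (v x - u 0%N x) + u 0%N x).
  apply: (pintegrableD p1 pq) => //; split; last by have [] := vM 0%N.
  by apply: measurable_funB => //; have [] := ui 0%N.
by apply/funext => x; rewrite subrK.
Qed.

End fast_cauchy_lim.

(** * Weighted power integrals *)

Section weighted_power_integral.
Context d (Y : measurableType d) (R : realType).
Variable nu : {measure set Y -> \bar R}.
Variables (p q : R) (k : Y -> R) (kmin kmax : R).
Hypotheses (p1 : 1 < p) (pq : p^-1 + q^-1 = 1).
Hypotheses (mk : measurable_fun setT k) (kmin0 : 0 < kmin).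
Hypothesis kle : forall z, kmin <= k z <= kmax.
Implicit Types a b g : Y -> R.

Let k0 z : 0 <= k z.
Proof. by rewrite (le_trans (ltW kmin0))//; case/andP : (kle z). Qed.

Lemma integrable_weight (h : Y -> R) : nu.-integrable setT (EFin \o h) ->
  nu.-integrable setT (EFin \o (fun z => k z * h z)).
Proof.
move=> hi; apply: (@le_integrable_normr _ _ _ _ _ (fun z => kmax * `|h z|)).
- by apply: measurable_funM => //; exact: integrable_measurable hi.
- move=> z; rewrite normrM ler_wpM2r// ger0_norm//.
  by case/andP : (kle z).
- by apply: integrableZl_EFin; exact: integrable_norm.
Qed.

Lemma le_Rintegral_weight (h : Y -> R) : (forall z, 0 <= h z) ->
  nu.-integrable setT (EFin \o h) ->
  kmin * \int[nu]_z h z <= \int[nu]_z (k z * h z).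
Proof.
move=> h0 hi; rewrite -RintegralZl//; apply: le_Rintegral => //.
- exact: integrableZl_EFin.
- exact: integrable_weight.
- by move=> z _; rewrite ler_wpM2r//; case/andP : (kle z).
Qed.

Lemma normr_spowM_le (x y : R) :
  `|spow (p - 1) x * y| <= `|x| `^ p + `|y| `^ p.
Proof.
have pB0 : p - 1 != 0 by rewrite gt_eqF// subr_gt0.
have q0 : 0 < q by exact: lt_trans ltr01 (conjugate_gt1r p1 pq).
have p0 : 0 < p by exact: lt_trans p1.
have := young_normr p1 pq y (spow (p - 1) x) ltr01.
rewrite !powR1 !mul1r normr_spow// -powRrM conjugateB1M//.
by rewrite (mulrC y) [leRHS]addrC.
Qed.

Lemma integrable_weight_spow a b : pintegrable nu p a -> pintegrable nu p b ->
  nu.-integrable setT (EFin \o (fun z => k z * (spow (p - 1) (a z) * b z))).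
Proof.
move=> [ma ai] [mb bi]; apply: integrable_weight.
apply: (@le_integrable_normr _ _ _ _ _ (fun z => `|a z| `^ p + `|b z| `^ p)).
- apply: measurable_funM => //; apply: (measurableT_comp _ ma).
  by apply: continuous_measurable_fun; apply: continuous_spow; rewrite subr_gt0.
- by move=> z; exact: normr_spowM_le.
- exact: integrableD_EFin.
Qed.

Lemma weighted_power_tangent a b : pintegrable nu p a -> pintegrable nu p b ->
  \int[nu]_z (k z * (spow (p - 1) (a z) * (a z - b z))) >=
  p^-1 * (\int[nu]_z (k z * `|a z| `^ p) - \int[nu]_z (k z * `|b z| `^ p)).
Proof.
move=> ai bi; have abi := pintegrableB p1 pq ai bi.
have [_ aI] := ai; have [_ bI] := bi.
rewrite -RintegralB// -?RintegralZl//; try exact: integrable_weight; last first.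
  by apply: integrableB_EFin; exact: integrable_weight.
apply: le_Rintegral => //.
- apply: integrableZl_EFin.
  by apply: integrableB_EFin; exact: integrable_weight.
- exact: integrable_weight_spow.
- move=> z _; rewrite -mulrBr mulrCA ler_wpM2l//.
  by have := normr_powR_tangent p1 pq (a z) (b z); lra.
Qed.

Lemma cvg_weight_spow a b : pintegrable nu p a -> pintegrable nu p b ->
  \int[nu]_z (k z * (spow (p - 1) (a z + n.+1%:R^-1 * b z) * b z)) @[n --> \oo]
    --> \int[nu]_z (k z * (spow (p - 1) (a z) * b z)).
Proof.
move=> ai bi; have [ma aI] := ai; have [mb bI] := bi.
have p0 : 0 < p by exact: lt_trans p1.
have tbi n : pintegrable nu p (fun z => a z + n.+1%:R^-1 * b z).
  by apply: (pintegrableD p1 pq) => //; exact: pintegrableZ.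
have fi n := integrable_weight_spow (tbi n) bi.
(* The dominating function comes from [normr_spowM_le] and [normrD_powR]; it is independent of [n]
   because the factors 1/(n+1) are at most 1. *)
have := @dominated_convergence _ _ _ nu setT measurableT
  (fun n z => (k z * (spow (p - 1) (a z + n.+1%:R^-1 * b z) * b z))%:E)
  (fun z => (k z * (spow (p - 1) (a z) * b z))%:E)
  (fun z => (kmax * (2 `^ p * (`|a z| `^ p + `|b z| `^ p) + `|b z| `^ p))%:E).
case.
- by move=> n; exact: measurable_int (fi n).
- exact: measurable_int (integrable_weight_spow ai bi).
- apply: aeW => z _; apply: cvg_EFin; first exact: nearW.
  apply: cvgM; first exact: cvg_cst.
  apply: cvgM; last exact: cvg_cst.
  have abz : a z + n.+1%:R^-1 * b z @[n --> \oo] --> a z.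
    rewrite -[X in _ --> X]addr0 -[X in a z + X](mul0r (b z)).
    apply: cvgD; first exact: cvg_cst.
    by apply: cvgM; [exact: cvg_harmonic|exact: cvg_cst].
  apply: (@cvg_comp _ _ _ (fun n => a z + n.+1%:R^-1 * b z) _ _ _ _ abz).
  by apply: continuous_spow; rewrite subr_gt0.
- apply: integrableZl_EFin; apply: integrableD_EFin => //.
  by apply: integrableZl_EFin; exact: integrableD_EFin.
- apply: aeW => z n _; rewrite /= lee_fin normrM ger0_norm//.
  apply: ler_pM => //; first by case/andP : (kle z).
  apply: (le_trans (normr_spowM_le _ _)); rewrite lerD2r.
  apply: (le_trans (normrD_powR p1 pq _ _)); rewrite ler_pM2l ?powR_gt0// lerD2l.
  apply: ge0_ler_powR; rewrite ?nnegrE ?(ltW p0)//.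
  by rewrite normrM ler_piMl// ger0_norm ?invr_ge0// invf_le1// ler1n.
- move=> fI _ /= h; apply: fine_cvg.
  by rewrite /Rintegral fineK//; exact: integrable_fin_num.
Qed.

End weighted_power_integral.

(** * Minimisation and the Euler-Lagrange equation *)

Section minimisation.
Context dX (X : measurableType dX) dY (Y : measurableType dY) (R : realType).
Variables (mu : {measure set X -> \bar R}) (nu : {measure set Y -> \bar R}).
Variables (p q : R) (k : Y -> R) (kmin kmax : R) (f : X -> R).
Variables (U : set (X -> R)) (G : (X -> R) -> Y -> R) (C : R).
Hypotheses (p1 : 1 < p) (pq : p^-1 + q^-1 = 1).
Hypotheses (mk : measurable_fun setT k) (kmin0 : 0 < kmin).
Hypothesis kle : forall z, kmin <= k z <= kmax.
Hypothesis fi : pintegrable mu q f.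
Hypothesis U0 : U (cst 0).
Hypothesis U_lin : forall u v t, U u -> U v -> U (fun x => u x + t * v x).
Hypothesis G_lin : forall u v t,
  G (fun x => u x + t * v x) = (fun z => G u z + t * G v z).
Hypothesis U_pintegrable : forall u, U u -> pintegrable mu p u.
Hypothesis G_pintegrable : forall u, U u -> pintegrable nu p (G u).
Hypothesis C0 : 0 <= C.
Hypothesis poincare : forall u, U u ->
  \int[mu]_x (`|u x| `^ p) <= C * \int[nu]_z (`|G u z| `^ p).
(** The limit may be modified on a null set. Membership of [v] in [U] is conditional: convergence
    almost everywhere does not tell that [G v] is p-integrable, which only the energy bound yields
    later. *)
Hypothesis U_closed : forall (u_ : nat -> X -> R) u, (forall j, U (u_ j)) ->
  pintegrable mu p u -> {ae mu, forall x, u_ ^~ x @ \oo --> u x} ->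
  exists v, [/\ {ae mu, forall x, u x = v x}, measurable_fun setT v,
    measurable_fun setT (G v),
    {ae nu, forall z, (fun j => G (u_ j) z) @ \oo --> G v z} &
    pintegrable mu p v -> pintegrable nu p (G v) -> U v].

Definition energy u : R :=
  p^-1 * \int[nu]_z (k z * `|G u z| `^ p) + \int[mu]_x (f x * u x).

Let p0 : 0 < p. Proof. exact: lt_trans p1. Qed.
Let q0 : 0 < q.
Proof. exact: lt_trans ltr01 (conjugate_gt1r p1 pq). Qed.

Let ikG u : U u -> nu.-integrable setT (EFin \o (fun z => k z * `|G u z| `^ p)).
Proof. by move=> /G_pintegrable[_ h]; exact: (integrable_weight mk kmin0 kle). Qed.

Let ifu u : U u -> mu.-integrable setT (EFin \o (fun x => f x * u x)).
Proof. by move=> Uu; exact: (pintegrable_integrableM p1 pq fi (U_pintegrable Uu)). Qed.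

Lemma energy_coercive : exists2 M, 0 <= M & forall u, U u ->
  \int[nu]_z (`|G u z| `^ p) <= 2 * p / kmin * (energy u + M).
Proof.
(* With this [s], [C] times [s] to the power [p] is at most [kmin / (2 * p)]: the linear term
   absorbs no more than half of the lower bound [kmin / p] on the nonlinear one, up to a constant.
   The [C + 1] avoids a zero denominator. *)
pose s := (kmin / (2 * p * (C + 1))) `^ p^-1.
have C10 : 0 < C + 1 by exact: ltr_wpDl.
have s0 : 0 < s by rewrite powR_gt0// divr_gt0// !mulr_gt0.
have sp : s `^ p = kmin / (2 * p * (C + 1)).
  by rewrite -powRrM mulVf ?gt_eqF// powRr1// ltW// divr_gt0// !mulr_gt0.
pose F := \int[mu]_x (`|f x| `^ q).
have F0 : 0 <= F by apply: Rintegral_ge0 => x _; exact: powR_ge0.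
exists (s `^ (- q) * F); first by rewrite mulr_ge0 ?powR_ge0.
move=> u Uu; set N := \int[nu]_z (`|G u z| `^ p).
have N0 : 0 <= N by apply: Rintegral_ge0 => x _; exact: powR_ge0.
have := normr_Rintegral_young p1 pq s0 fi (U_pintegrable Uu).
rewrite -/F; set I := \int[mu]_x (f x * u x) => HI.
have H1 : s `^ p * \int[mu]_x (`|u x| `^ p) <= kmin / (2 * p) * N.
  apply: (@le_trans _ _ (s `^ p * (C * N))).
    by rewrite ler_wpM2l ?powR_ge0//; exact: poincare.
  rewrite sp mulrA ler_wpM2r//.
  have -> : kmin / (2 * p * (C + 1)) * C = kmin / (2 * p) * (C / (C + 1)).
    by field; rewrite !gt_eqF.
  rewrite ler_piMr//; first by rewrite ltW// divr_gt0// mulr_gt0.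
  by rewrite ler_pdivrMr// mul1r lerDl.
have H2 : kmin * N <= \int[nu]_z (k z * `|G u z| `^ p).
  have [_ iG] := G_pintegrable Uu.
  by apply: (le_Rintegral_weight mk kmin0 kle) => // z; exact: powR_ge0.
have H3 : p^-1 * (kmin * N) <= p^-1 * \int[nu]_z (k z * `|G u z| `^ p).
  by rewrite ler_pM2l// invr_gt0.
have H4 : - I <= kmin / (2 * p) * N + s `^ (- q) * F.
  by rewrite (le_trans (ler_norm _))// normrN (le_trans HI)// lerD2r.
have H5 : kmin / (2 * p) * N <= energy u + s `^ (- q) * F.
  rewrite /energy -/I.
  have E : p^-1 * (kmin * N) = 2 * (kmin / (2 * p) * N) by field; rewrite gt_eqF.
  lra.
have -> : N = 2 * p / kmin * (kmin / (2 * p) * N).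
  by field; rewrite !gt_eqF.
by rewrite ler_wpM2l// divr_ge0 ?mulr_ge0// ltW.
Qed.

Let infE := inf [set energy u | u in U].

Lemma has_inf_energy : has_inf [set energy u | u in U].
Proof.
split; first by exists (energy (cst 0)), (cst 0).
have [M M0 coer] := energy_coercive.
exists (- M) => _ [u Uu <-]; rewrite -subr_ge0 opprK.
have := coer _ Uu; have N0 : 0 <= \int[nu]_z (`|G u z| `^ p).
  by apply: Rintegral_ge0 => x _; exact: powR_ge0.
move=> /(le_trans N0); rewrite pmulr_rge0//.
by rewrite divr_gt0// mulr_gt0.
Qed.

Lemma inf_energy_le u : U u -> infE <= energy u.
Proof. by move=> Uu; apply: ge_inf; [have [] := has_inf_energy|exists u]. Qed.

Let midE u v z :
  G (fun x => 2^-1 * (u x + v x)) z = (G u z + G v z) / 2.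
Proof.
have -> : (fun x => 2^-1 * (u x + v x)) =
    (fun x => (u x + (- 2^-1) * u x) + 2^-1 * v x).
  by apply/funext => x; field.
by rewrite !G_lin; field.
Qed.

Let Umid u v : U u -> U v -> U (fun x => 2^-1 * (u x + v x)).
Proof.
move=> Uu Uv; have -> : (fun x => 2^-1 * (u x + v x)) =
    (fun x => (u x + (- 2^-1) * u x) + 2^-1 * v x).
  by apply/funext => x; field.
by apply: U_lin => //; exact: U_lin.
Qed.

Let subE (u v : X -> R) : (fun x => u x - v x) = (fun x => u x + (- 1) * v x).
Proof. by apply/funext => x; rewrite mulN1r. Qed.

(** The midpoint is again a competitor, so its energy is at least [infE]. In the mean of the two
    energies minus the energy of the midpoint the linear term cancels, leaving the convexity gap
    weighted by [k]; the gap is nonnegative, so the weight can be bounded below by [kmin]. *)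
Lemma energy_midpoint u v : U u -> U v ->
  \int[nu]_z ((`|G u z| `^ p + `|G v z| `^ p) / 2 -
    `|(G u z + G v z) / 2| `^ p) <=
  p / kmin * ((energy u + energy v) / 2 - infE).
Proof.
move=> Uu Uv; have Um := Umid Uu Uv.
have [_ iu] := G_pintegrable Uu; have [_ iv] := G_pintegrable Uv.
have [_] := G_pintegrable Um.
under [X in EFin \o X]eq_fun do rewrite midE.
move=> im.
pose D z := 2^-1 * (`|G u z| `^ p + `|G v z| `^ p) - `|(G u z + G v z) / 2| `^ p.
have iD : nu.-integrable setT (EFin \o D).
  by apply: integrableB_EFin => //; apply: integrableZl_EFin; exact: integrableD_EFin.
rewrite (_ : (fun _ => _) = D); last first.
  by apply/funext => z; rewrite /D [2^-1 * _]mulrC.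
have D0 z : 0 <= D z.
  by rewrite /D subr_ge0 [leRHS]mulrC; exact: (midpoint_normr_powR p1 pq).
have := le_Rintegral_weight mk kmin0 kle D0 iD.
have -> : \int[nu]_z (k z * D z) =
    p * ((energy u + energy v) / 2 - energy (fun x => 2^-1 * (u x + v x))).
  have -> : \int[nu]_z (k z * D z) = 2^-1 * (\int[nu]_z (k z * `|G u z| `^ p) +
      \int[nu]_z (k z * `|G v z| `^ p)) -
      \int[nu]_z (k z * `|(G u z + G v z) / 2| `^ p).
    have iku := ikG Uu; have ikv := ikG Uv.
    have ikm := integrable_weight mk kmin0 kle im.
    rewrite -RintegralD// -RintegralZl//; last exact: integrableD_EFin.
    rewrite -RintegralB//; last by apply: integrableZl_EFin; exact: integrableD_EFin.
    by apply: eq_Rintegral => z _; rewrite /D; ring.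
  rewrite /energy.
  have -> : \int[mu]_x (f x * (2^-1 * (u x + v x))) =
      2^-1 * (\int[mu]_x (f x * u x) + \int[mu]_x (f x * v x)).
    have iu' := ifu Uu; have iv' := ifu Uv.
    rewrite -RintegralD// -RintegralZl//; last exact: integrableD_EFin.
    by apply: eq_Rintegral => x _; ring.
  have -> : \int[nu]_z (k z * `|G (fun x => 2^-1 * (u x + v x)) z| `^ p) =
      \int[nu]_z (k z * `|(G u z + G v z) / 2| `^ p).
    by apply: eq_Rintegral => z _; rewrite midE.
  by field; rewrite gt_eqF.
move=> H; rewrite mulrAC ler_pdivlMr// mulrC (le_trans H)// ler_pM2l// lerD2l lerN2.
exact: inf_energy_le.
Qed.

(** Integrating the uniform convexity inequality bounds the distance of the gradients by two terms.
    [B] bounds both gradient integrals once the energies are below [infE + 1], so the parameter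
    [e' / (4 * B)] makes the first term at most [e' / 2]; the second is controlled by
    [energy_midpoint]. The Poincare inequality then passes from gradients to functions, and
    [C * e' <= e]. *)
Lemma energy_cauchy e : 0 < e -> exists2 eta, 0 < eta & forall u v, U u -> U v ->
  energy u <= infE + eta -> energy v <= infE + eta ->
  \int[mu]_x (`|u x - v x| `^ p) <= e.
Proof.
move=> e0; have [M M0 coer] := energy_coercive.
have C10 : 0 < C + 1 by exact: ltr_wpDl.
pose B := 2 * p / kmin * (infE + 1 + M).
have pk0 : 0 < 2 * p / kmin by rewrite divr_gt0// mulr_gt0.
have infM : 0 <= infE + M.
  rewrite -[M]opprK subr_ge0; apply: lb_le_inf.
    by have [] := has_inf_energy.
  move=> _ [u Uu <-]; rewrite -subr_ge0 opprK.
  have N0 : 0 <= \int[nu]_z (`|G u z| `^ p).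
    by apply: Rintegral_ge0 => x _; exact: powR_ge0.
  by have := le_trans N0 (coer _ Uu); rewrite pmulr_rge0.
have B0 : 0 < B by rewrite mulr_gt0//; lra.
pose e' := e / (C + 1).
have e'0 : 0 < e' by rewrite divr_gt0.
have e4B : 0 < e' / (4 * B) by rewrite divr_gt0// mulr_gt0.
have [c c0 conv] := uniform_convexity_normr_powR p1 pq e4B.
have cp : 0 < 2 * (c + 1) * p by rewrite !mulr_gt0// ltr_wpDl.
(* The bound 1 keeps the energies in the range where [B] applies; the other entry makes
   [c * (p / kmin * eta)] at most [e' / 2]. *)
exists (Num.min 1 (e' * kmin / (2 * (c + 1) * p))).
  by rewrite lt_min ltr01 divr_gt0// mulr_gt0.
set eta := Num.min _ _ => u v Uu Uv Eu Ev.
have eta1 : eta <= 1 by rewrite ge_min lexx.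
have eta2 : eta <= e' * kmin / (2 * (c + 1) * p) by rewrite ge_min lexx orbT.
have GM w : U w -> energy w <= infE + eta -> \int[nu]_z (`|G w z| `^ p) <= B.
  move=> Uw Ew; apply: (le_trans (coer _ Uw)); rewrite ler_pM2l// lerD2r.
  by rewrite (le_trans Ew)// lerD2l.
have Uuv : U (fun x => u x - v x) by rewrite subE; exact: U_lin.
have GuvE z : G (fun x => u x - v x) z = G u z - G v z.
  by rewrite subE G_lin mulN1r.
have [_ iu] := G_pintegrable Uu; have [_ iv] := G_pintegrable Uv.
have Guv : \int[nu]_z (`|G u z - G v z| `^ p) <= e'.
  have [_] := G_pintegrable Uuv; under [X in EFin \o X]eq_fun do rewrite GuvE.
  move=> iuv; have [_] := G_pintegrable (Umid Uu Uv).
  under [X in EFin \o X]eq_fun do rewrite midE.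
  move=> im; pose D z := (`|G u z| `^ p + `|G v z| `^ p) / 2 -
    `|(G u z + G v z) / 2| `^ p.
  have iD : nu.-integrable setT (EFin \o D).
    apply: integrableB_EFin => //.
    rewrite (_ : (fun _ => _) = (fun z => 2^-1 * (`|G u z| `^ p + `|G v z| `^ p))).
      by apply: integrableZl_EFin; exact: integrableD_EFin.
    by apply/funext => z; rewrite mulrC.
  have iS := integrableD_EFin iu iv.
  apply: (@le_trans _ _ (\int[nu]_z (e' / (4 * B) * (`|G u z| `^ p + `|G v z| `^ p) +
      c * D z))).
    apply: le_Rintegral => //.
    by apply: integrableD_EFin; exact: integrableZl_EFin.
  rewrite RintegralD//; try exact: integrableZl_EFin.
  rewrite !RintegralZl// RintegralD//.
  have H1 : e' / (4 * B) * (\int[nu]_z (`|G u z| `^ p) + \int[nu]_z (`|G v z| `^ p))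
      <= e' / 2.
    apply: (@le_trans _ _ (e' / (4 * B) * (B + B))).
      by rewrite ler_pM2l//; apply: lerD; exact: GM.
    by rewrite le_eqVlt; apply/orP; left; apply/eqP; field; rewrite gt_eqF.
  have H2 : c * \int[nu]_z D z <= e' / 2.
    apply: (@le_trans _ _ (c * (p / kmin * eta))).
      rewrite ler_wpM2l// (le_trans (energy_midpoint Uu Uv))// ler_wpM2l//.
        by rewrite divr_ge0// ltW.
      by lra.
    apply: (@le_trans _ _ (c * (p / kmin * (e' * kmin / (2 * (c + 1) * p))))).
      by rewrite !ler_wpM2l// divr_ge0// ltW.
    have -> : c * (p / kmin * (e' * kmin / (2 * (c + 1) * p))) =
        e' / 2 * (c / (c + 1)).
      by field; rewrite !gt_eqF// ltr_wpDl.
    rewrite ler_piMr//; first by rewrite divr_ge0// ltW.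
    by rewrite ler_pdivrMr ?ltr_wpDl// mul1r lerDl.
  by rewrite (le_trans (lerD H1 H2))// -splitr.
apply: (le_trans (poincare Uuv)).
under eq_Rintegral do rewrite GuvE.
apply: (@le_trans _ _ (C * e')); first by rewrite ler_wpM2l.
rewrite /e' mulrCA ler_piMr ?(ltW e0)// ler_pdivrMr// mul1r lerDl//.
Qed.


Lemma energy_minimiser : exists2 u, U u & forall v, U v -> energy u <= energy v.
Proof.
pose e j := 2^-1 ^+ j * (2^-1 ^+ j) `^ p : R.
have half0 j : 0 < 2^-1 ^+ j :> R by rewrite exprn_gt0.
have e0 j : 0 < e j by rewrite mulr_gt0// powR_gt0.
have /choice[eta etaP] : forall j, exists eta, 0 < eta /\ forall u v, U u -> U v ->
    energy u <= infE + eta -> energy v <= infE + eta ->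
    \int[mu]_x (`|u x - v x| `^ p) <= e j.
  by move=> j; have [eta eta0 etaP] := energy_cauchy (e0 j); exists eta.
(* As [dl m] lies below [eta j] for every [j <= m], all [u_ m] with [m >= j] meet the Cauchy
   criterion at level [j] at once. The powers of 1/2 force the energies to tend to [infE]. *)
pose dl m := \big[Num.min/1]_(i < m.+1) Num.min (eta i) (2^-1 ^+ i).
have dl0 m : 0 < dl m.
  apply/bigmin_gtP; split => // i _.
  by rewrite lt_min half0 andbT; have [] := etaP i.
have dlle j m : (j <= m)%N -> dl m <= Num.min (eta j) (2^-1 ^+ j).
  rewrite -ltnS => jm.
  exact: (bigmin_le _ (Ordinal jm) (fun i : 'I_m.+1 => Num.min (eta i) (2^-1 ^+ i))).
have /choice[u_ uP] : forall m, exists u, U u /\ energy u <= infE + dl m.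
  move=> m; have [_ [u Uu <-] um] := inf_adherent (dl0 m) has_inf_energy.
  by exists u; split => //; exact: ltW.
have Uu_ j : U (u_ j) by have [] := uP j.
have uM j m : (j <= m)%N -> \int[mu]_x (`|u_ m x - u_ j x| `^ p) <= e j.
  have le_eta i : (j <= i)%N -> energy (u_ i) <= infE + eta j.
    move=> ji; have [_ /le_trans] := uP i; apply; rewrite lerD2l.
    by rewrite (le_trans (dlle _ _ ji))// ge_min lexx.
  by move=> jm; have [_] := etaP j; apply => //; exact: le_eta.
have [v [vi uv vM]] :=
  pintegrable_fast_cauchy_lim p1 pq (fun j => U_pintegrable (Uu_ j)) uM.
have [w [vw mw mGw uGw Uw]] := U_closed Uu_ vi uv.
have [mv vI] := vi; have [mf _] := fi.
have wi : pintegrable mu p w.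
  split => //; apply: ae_eq_integrable vI; first exact: measurable_normr_powR.
  by apply: filterS vw => x ->.
have fvw : \int[mu]_x (f x * w x) = \int[mu]_x (f x * v x).
  apply: ae_eq_Rintegral; [exact: measurable_funM|exact: measurable_funM|].
  by apply: filterS vw => x ->.
pose F := \int[mu]_x (`|f x| `^ q).
have F0 : 0 <= F by apply: Rintegral_ge0 => x _; exact: powR_ge0.
(* The error [eps] splits into [eps / 2] for the energy excess of the tail and twice [eps / 4] for
   replacing the linear term of [u_ n] by that of [v]: the weight [s] is large enough for the part
   with [f], and then [n] is large enough for the part with [v - u_ n]. Fatou's lemma along the tail
   gives the bound for [w]. *)
have key (eps : R) : 0 < eps ->
    nu.-integrable setT (EFin \o (fun z => k z * `|G w z| `^ p)) /\
    \int[nu]_z (k z * `|G w z| `^ p) <= p * (infE - \int[mu]_x (f x * v x) + eps).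
  move=> eps0; have F10 : 0 < F + 1 by exact: ltr_wpDl.
  pose s := (4 * (F + 1) / eps) `^ q^-1.
  have s0 : 0 < s by rewrite powR_gt0// divr_gt0// mulr_gt0.
  have sq : s `^ (- q) * F <= eps / 4.
    rewrite powRN /s -powRrM mulVf ?gt_eqF// powRr1; last first.
      by rewrite ltW// divr_gt0// mulr_gt0.
    have -> : (4 * (F + 1) / eps)^-1 * F = eps / 4 * (F / (F + 1)).
      by field; rewrite !gt_eqF.
    rewrite ler_piMr//; first by rewrite ltW// divr_gt0.
    by rewrite ler_pdivrMr// mul1r lerDl.
  have [K KP] : exists K, forall n, (K <= n)%N ->
      2^-1 ^+ n <= Num.min (eps / 2) (eps / 4 / s `^ p).
    have : (fun n => 2^-1 ^+ n : R) @ \oo --> (0 : R).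
      by apply: cvg_expr; rewrite ger0_norm// invf_lt1// ltr1n.
    move=> /cvgrPdist_le /(_ (Num.min (eps / 2) (eps / 4 / s `^ p))).
    have -> : 0 < Num.min (eps / 2) (eps / 4 / s `^ p).
      by rewrite lt_min !divr_gt0// powR_gt0.
    move=> /(_ isT)[K _ KP]; exists K => n /KP /=.
    by rewrite sub0r normrN ger0_norm// ltW.
  have bound n : (K <= n)%N -> \int[nu]_z (k z * `|G (u_ n) z| `^ p) <=
      p * (infE - \int[mu]_x (f x * v x) + eps).
    move=> Kn; have := KP _ Kn; rewrite le_min => /andP[K1 K2].
    have : energy (u_ n) <= infE + eps / 2.
      have [_ /le_trans] := uP n; apply; rewrite lerD2l.
      by rewrite (le_trans (dlle _ _ (leqnn n)))// ge_min K1 orbT.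
    have vui : pintegrable mu p (fun x => v x - u_ n x).
      exact: (pintegrableB p1 pq vi (U_pintegrable (Uu_ n))).
    have := normr_Rintegral_young p1 pq s0 fi vui; rewrite -/F.
    have -> : \int[mu]_x (f x * (v x - u_ n x)) =
        \int[mu]_x (f x * v x) - \int[mu]_x (f x * u_ n x).
      rewrite -RintegralB//; last 2 first.
      - exact: (pintegrable_integrableM p1 pq).
      - exact: ifu.
      - by apply: eq_Rintegral => x _; rewrite mulrBr.
    have en : s `^ p * \int[mu]_x (`|v x - u_ n x| `^ p) <= eps / 4.
      have sp0 : 0 < s `^ p by exact: powR_gt0.
      rewrite -(ler_pdivlMl _ _ sp0) [leRHS]mulrC; apply: (le_trans (vM n)).
      apply: le_trans K2.
      rewrite ler_piMr ?(ltW (half0 n))//.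
      have p1E : 1 `^ p = 1 :> R by rewrite powR1.
      rewrite -[leRHS]p1E.
      apply: ge0_ler_powR; rewrite ?nnegrE ?(ltW p0) ?(ltW (half0 n))//.
      by apply: exprn_ile1 => //; rewrite invf_le1 ?ler1n.
    move=> H1; rewrite /energy => H2.
    rewrite -ler_pdivrMl//.
    have := ler_norm (\int[mu]_x (f x * v x) - \int[mu]_x (f x * u_ n x)).
    lra.
  apply: (@fatou_ae _ _ _ _ (fun n z => k z * `|G (u_ (n + K)%N) z| `^ p)).
  - move=> n; apply: measurable_funM => //; apply: measurable_normr_powR.
    by have [] := G_pintegrable (Uu_ (n + K)%N).
  - by apply: measurable_funM => //; exact: measurable_normr_powR.
  - move=> n z; rewrite mulr_ge0 ?powR_ge0// (le_trans (ltW kmin0))//.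
    by case/andP : (kle z).
  - move=> z; rewrite mulr_ge0 ?powR_ge0// (le_trans (ltW kmin0))//.
    by case/andP : (kle z).
  - apply: filterS uGw => z uz; apply: cvgM; first exact: cvg_cst.
    have uz' : G (u_ (n + K)%N) z @[n --> \oo] --> G w z.
      by move: uz; rewrite -(cvg_shiftn K).
    apply: (@cvg_comp _ _ _ _ (fun y => `|y| `^ p) _ _ _ uz').
    exact: continuous_normr_powR.
  - move=> n; rewrite -EFin_Rintegral ?lee_fin; last exact: ikG.
    by apply: bound; exact: leq_addl.
(* One instance of the bound already gives p-integrability of [G w], since [k >= kmin]; this
   discharges the condition left open in [U_closed]. *)
have [ikw _] := key 1 ltr01.
have Gwi : pintegrable nu p (G w).
  split => //; apply: (@le_integrable_normr _ _ _ _ _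
    (fun z => kmin^-1 * (k z * `|G w z| `^ p))).
  - exact: measurable_normr_powR.
  - move=> z; rewrite ger0_norm ?powR_ge0// mulrA ler_peMl ?powR_ge0//.
    by rewrite mulrC ler_pdivlMr// mul1r; case/andP : (kle z).
  - exact: integrableZl_EFin.
have {}Uw := Uw wi Gwi.
exists w => // u' Uu'; apply: le_trans (inf_energy_le Uu').
apply/ler_addgt0Pr => eps eps0; have [_] := key eps eps0.
rewrite -ler_pdivrMl// /energy fvw; lra.
Qed.

(** The energy is not differentiated. The tangent inequality at the perturbed gradient
    [G u + t * G v] bounds the energy increment from above by [t] times the would-be derivative
    there; minimality makes this nonnegative, and dominated convergence lets [t] tend to 0. Applying
    the resulting inequality to [v] and [- v] gives the equation. *)
Lemma energy_euler_lagrange u : U u -> (forall v, U v -> energy u <= energy v) ->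
  forall v, U v ->
  \int[nu]_z (k z * (spow (p - 1) (G u z) * G v z)) + \int[mu]_x (f x * v x) = 0.
Proof.
move=> Uu umin; have Gui := G_pintegrable Uu.
have ge0 v : U v ->
    0 <= \int[nu]_z (k z * (spow (p - 1) (G u z) * G v z)) + \int[mu]_x (f x * v x).
  move=> Uv; have Gvi := G_pintegrable Uv.
  have := cvg_weight_spow p1 pq mk kmin0 kle Gui Gvi.
  set L := fun n : nat => _ => cvgL.
  have {}cvgL : (fun n => L n + \int[mu]_x (f x * v x)) @ \oo -->
      \int[nu]_z (k z * (spow (p - 1) (G u z) * G v z)) + \int[mu]_x (f x * v x).
    by apply: cvgD => //; exact: cvg_cst.
  rewrite -(cvg_lim _ cvgL)//; apply: limr_ge; first exact: cvgP cvgL.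
  apply: nearW => n; set t : R := n.+1%:R^-1.
  have t0 : 0 < t by rewrite invr_gt0.
  have Uuv : U (fun x => u x + t * v x) by exact: U_lin.
  have := umin _ Uuv; have := G_pintegrable Uuv.
  rewrite /energy G_lin => ai.
  have := weighted_power_tangent p1 pq mk kmin0 kle ai Gui.
  have -> : \int[nu]_z (k z * (spow (p - 1) (G u z + t * G v z) *
      (G u z + t * G v z - G u z))) = t * L n.
    have iL := integrable_weight_spow p1 pq mk kmin0 kle ai Gvi.
    by rewrite -RintegralZl//; apply: eq_Rintegral => z _; rewrite -/t; ring.
  have -> : \int[mu]_x (f x * (u x + t * v x)) =
      \int[mu]_x (f x * u x) + t * \int[mu]_x (f x * v x).
    have iu := ifu Uu; have iv := ifu Uv.
    rewrite -RintegralZl// -RintegralD//; last exact: integrableZl_EFin.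
    by apply: eq_Rintegral => x _; ring.
  by move=> H1 H2; rewrite -(pmulr_rge0 _ t0); lra.
move=> v Uv; apply/eqP; rewrite eq_le ge0// andbT.
(* This is [- v], written in the only shape of combination that [U_lin] and [G_lin] provide. *)
have UNv : U (fun x => v x + (- 2) * v x) by exact: U_lin.
have Gvi := G_pintegrable Uv.
have iL := integrable_weight_spow p1 pq mk kmin0 kle Gui Gvi.
have := ge0 _ UNv; rewrite G_lin.
have -> : \int[nu]_z (k z * (spow (p - 1) (G u z) * (G v z + - 2 * G v z))) =
    - 1 * \int[nu]_z (k z * (spow (p - 1) (G u z) * G v z)).
  by rewrite -RintegralZl//; apply: eq_Rintegral => z _; ring.
have -> : \int[mu]_x (f x * (v x + - 2 * v x)) = - 1 * \int[mu]_x (f x * v x).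
  by rewrite -RintegralZl//; [apply: eq_Rintegral => x _; ring|exact: ifu].
lra.
Qed.

End minimisation.

(** * Weak* compactness and measurability *)

(* The filter base [{k in A | F k < r}], [r > inf F], clusters in [A]. *)
Lemma compact_max_continuous_attains_inf (R : realType) (T : topologicalType)
    (I : Type) (J : I -> T -> R) (A : set T) (F : T -> \bar R) :
  compact A -> A !=set0 -> (forall i, continuous (J i)) ->
  (forall k, A k -> forall i, ((J i k)%:E <= F k)%E) ->
  (forall k, A k -> exists i, (F k <= (J i k)%:E)%E) ->
  exists2 k, A k & F k = ereal_inf [set F k | k in A].
Proof.
move=> cA [k0 Ak0] cJ JF FJ; set m := ereal_inf _.
pose D := [set r : R | (m < r%:E)%E].
pose B r := [set k | A k /\ (F k < r%:E)%E].
have D0 : D !=set0.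
  have [i Fi] := FJ _ Ak0; exists (J i k0 + 1); rewrite /D/=.
  apply: (@le_lt_trans _ _ (F k0)); first by apply: ereal_inf_lbound; exists k0.
  by apply: (le_lt_trans Fi); rewrite lte_fin ltrDl.
have FB : ProperFilter (filter_from D B).
  apply: filter_from_proper; last first.
    by move=> r /ereal_inf_lt[_ [k Ak <-] Fk]; exists k.
  apply: filter_from_filter => // r s Dr Ds.
  exists (Num.min r s); first by rewrite /D/= EFin_min lt_min Dr Ds.
  by move=> k [Ak]; rewrite EFin_min lt_min => /andP[? ?]; split; split.
have BA : filter_from D B A by have [r Dr] := D0; exists r => // k [].
have [k [Ak clk]] := cA _ FB BA.
exists k => //; apply/eqP; rewrite eq_le; apply/andP; split; last first.
  by apply: ereal_inf_lbound; exists k.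
(* If [m < J i k], choose a real [r] strictly between them. The neighbourhood where [J i > r] meets
   [B r] in some [l], and then r < J i l <= F l < r. *)
have [i Fi] := FJ _ Ak; apply: (le_trans Fi); rewrite leNgt; apply/negP => mJ.
have [r Dr rJ] : exists2 r, D r & r < J i k.
  suff : forall x : \bar R, (x < (J i k)%:E)%E ->
      exists2 r : R, (x < r%:E)%E & r < J i k by exact.
  case=> [x| |] xJ.
  - rewrite lte_fin in xJ; exists ((x + J i k) / 2); first by rewrite lte_fin; lra.
    by lra.
  - by move: xJ; rewrite ltNge leey.
  - by exists (J i k - 1); [exact: ltNyr|rewrite gtrBl].
have nJ : nbhs k [set l | r < J i l] by move/cvgr_gt : (cJ i k); exact.
have [l [[Al Fl] rl]] := clk (B r) _ (ex_intro2 _ _ _ Dr (fun _ h => h)) nJ.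
have := JF _ Al i; rewrite leNgt => /negP; apply.
by apply: (lt_trans Fl); rewrite lte_fin.
Qed.

Section enlarge_measurable.
Context {R : realType} {n : nat}.

Lemma nbhs_rV_rat (x : 'rV[R]_n) (B : set 'rV[R]_n) : nbhs x B ->
  exists a : 'rV[rat]_n, B (map_mx ratr a).
Proof.
move=> [P xP PB]; have /choice[a aP] : forall j, exists a : rat, P 0 j (ratr a).
  move=> j; have Px : (P 0 j)° !=set0 by exists (x 0 j); exact: (xP 0 j).
  have [r [Pr [a _ ar]]] := @dense_rat R (P 0 j)° Px (@open_interior _ _).
  by exists a; rewrite ar; exact: interior_subset.
by exists (\row_j a j); apply: PB => i j; rewrite !mxE ord1; exact: aP.
Qed.

Lemma continuous_enormB (y : 'rV[R]_n) :
  continuous (fun x : 'rV[R]_n => enorm (y - x)).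
Proof.
have h i : continuous (fun z : 'rV[R]_n => (y - z) 0 i).
  have -> : (fun z : 'rV[R]_n => (y - z) 0 i) = (fun z => y 0 i - z 0 i).
    by apply/funext => z; rewrite !mxE.
  move=> x; apply: (@continuousB _ _ _ (fun=> y 0 i) (fun z : 'rV[R]_n => z 0 i)).
    exact: cst_continuous.
  exact: coord_continuous.
move=> x.
have edot_cvg : edot (y - z) (y - z) @[z --> x] --> edot (y - x) (y - x).
  apply: cvg_big => [||i _]; [exact: add_continuous|exact: (nbhs_filter x)|].
  exact: (cvgM (h i x) (h i x)).
exact: (cvg_comp _ _ edot_cvg (@sqrt_continuous R _)).
Qed.

Lemma measurable_eball (x : 'rV[R]_n) (r : R) : measurable (eball x r).
Proof.
rewrite (_ : eball x r = (fun y => enorm (y - x)) @^-1` `]-oo, r[); last first.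
  by apply/seteqP; split => y /=; rewrite in_itv.
rewrite -[X in measurable X]setTI.
have m1 : measurable_fun [set: 'rV[R]_n] (fun y => enorm (y - x)).
  apply: (measurableT_comp measurable_enorm); apply: measurable_fun_rV => i.
  rewrite (_ : (fun _ => _) = fun z : 'rV[R]_n => z 0 i - x 0 i); last first.
    by apply/funext => z; rewrite !mxE.
  by apply: measurable_funB => //; exact: measurable_coord.
exact: m1.
Qed.

(** The union of balls is uncountable. For fixed [y] the centres in [Omega] at distance less than
    [delta] form an open set, so a nonempty one contains a rational point, and countably many balls
    suffice. *)
Lemma measurable_enlarge (Omega : set 'rV[R]_n) delta : open Omega ->
  measurable (enlarge Omega delta).
Proof.
move=> oO; rewrite (_ : enlarge Omega delta = \bigcup_(a : 'rV[rat]_n)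
    [set y | Omega (map_mx ratr a) /\ eball (map_mx ratr a) delta y]).
  apply: countable_bigcupT_measurable => [|a]; first exact: countableP.
  have [Oa|Oa] := pselect (Omega (map_mx ratr a)).
    rewrite (_ : [set _ | _] = eball (map_mx ratr a) delta).
      exact: measurable_eball.
    by apply/seteqP; split => y // [].
  rewrite (_ : [set _ | _] = set0) => //.
  by apply/seteqP; split => y // [].
apply/seteqP; split => y [x].
  move=> Ox yx.
  have [a [Oa ya]] : exists a : 'rV[rat]_n,
      (Omega `&` [set z | enorm (y - z) < delta]) (map_mx ratr a).
    apply: (nbhs_rV_rat (x := x)); apply: filterI; first exact: open_nbhs_nbhs.
    by move/cvgr_lt : (@continuous_enormB y x); exact.
  by exists a.
by move=> _ [Ox yx]; exists (map_mx ratr x).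
Qed.

End enlarge_measurable.

Section product_null_set.
Context d1 d2 (T1 : measurableType d1) (T2 : measurableType d2) (R : realType).
Variables (m1 : {sigma_finite_measure set T1 -> \bar R}).
Variables (m2 : {sigma_finite_measure set T2 -> \bar R}).

(** This carries convergence of [u x] almost everywhere over to differences [u x - u x'] on the
    product. A strip over a null set is null even if the other factor has infinite measure, because
    0 times infinity is 0. *)
Lemma ae_product_measure (P : set T1) (Q : set T2) :
  {ae m1, forall x, P x} -> {ae m2, forall y, Q y} ->
  {ae (m1 \x m2)%E, forall z, P z.1 /\ Q z.2}.
Proof.
move=> [N [mN N0 PN]] [M [mM M0 QM]].
have n1 : {ae (m1 \x m2)%E, forall z, P z.1}.
  exists (N `*` setT); split; first exact: measurableX.
    transitivity (m1 N * m2 setT)%E; first exact: product_measure1E.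
    by rewrite N0 mul0e.
  by move=> z /= Pz; split => //; exact: PN.
have n2 : {ae (m1 \x m2)%E, forall z, Q z.2}.
  exists (setT `*` M); split; first exact: measurableX.
    transitivity (m1 setT * m2 M)%E; first exact: product_measure1E.
    by rewrite M0 mule0.
  by move=> z /= Pz; split => //; exact: QM.
by apply: filterS2 n1 n2.
Qed.

End product_null_set.

Lemma Lnorm_le_Rintegral d1 d2 (T1 : measurableType d1) (T2 : measurableType d2)
    (R : realType) (m1 : {measure set T1 -> \bar R})
    (m2 : {measure set T2 -> \bar R}) (p C : R) (g : T1 -> R) (h : T2 -> R) :
  0 < p -> 0 <= C -> pintegrable m1 p g -> pintegrable m2 p h ->
  ('N[m1]_p%:E[EFin \o g] <= C%:E * 'N[m2]_p%:E[EFin \o h])%E ->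
  \int[m1]_x (`|g x| `^ p) <= C `^ p * \int[m2]_x (`|h x| `^ p).
Proof.
move=> p0 C0 [_ gi] [_ hi] gh.
have E d (T : measurableType d) (m : {measure set T -> \bar R}) (a : T -> R) :
    m.-integrable setT (EFin \o (fun x => `|a x| `^ p)) ->
    ('N[m]_p%:E[EFin \o a] `^ p)%E = (\int[m]_x (`|a x| `^ p))%:E.
  by move=> ai; rewrite poweR_Lnorm ?gt_eqF// EFin_Rintegral.
rewrite -lee_fin EFinM -E// -(E _ _ m2)// -poweR_EFin -poweRM ?lee_fin//; last first.
  exact: Lnorm_ge0.
apply: gt0_ler_poweR => //; first exact: ltW.
- by rewrite in_itv/= leey Lnorm_ge0.
- by rewrite in_itv/= leey mule_ge0 ?Lnorm_ge0// lee_fin.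
Qed.

(** * The nonlocal gradient *)

Lemma restrict0E (R : realType) T (D : set T) (g : T -> R) x :
  (g \_ D) x = if x \in D then g x else 0.
Proof. exact: patchE. Qed.

Section nonlocal_gradient.
Context {R : realType} {n : nat}.
Variables (p q delta : R) (w : 'rV[R]_n -> R) (Omega : set 'rV[R]_n).
Hypotheses (p1 : 1 < p) (pq : p^-1 + q^-1 = 1).
Hypotheses (mw : measurable_fun setT w) (oOmega : open Omega).

Local Notation X := 'rV[R]_n.
Local Notation mu := (lebesgue_rV n).
Local Notation mu2 := (lebesgue_rV n \x lebesgue_rV n)%E.
Local Notation S := (square Omega delta).
Implicit Types u v : X -> R.

Definition sqgrad u : X * X -> R := nlgrad w Omega u \_ S.

(** Elements of [Udelta0] normalised to vanish off [Omega]: [u] itself, not only its restriction, is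
    then p-integrable, and the abstract minimisation can work with integrals over the whole
    space. *)
Definition Usupp : set (X -> R) :=
  [set u | [/\ u \_ Omega = u, pintegrable mu p u & pintegrable mu2 p (sqgrad u)]].

Lemma patch_patch u : (u \_ Omega) \_ Omega = u \_ Omega.
Proof. by apply/funext => x; rewrite !restrict0E; case: (x \in Omega). Qed.

Lemma nlgrad_patch u : nlgrad w Omega (u \_ Omega) = nlgrad w Omega u.
Proof. by rewrite /nlgrad patch_patch. Qed.

Lemma Lp_on_pintegrable d (T : measurableType d)
    (m : {measure set T -> \bar R}) (D : set T) r (g : T -> R) : 1 <= r ->
  Lp_on m D r%:E g <-> pintegrable m r (g \_ D).
Proof. exact: Lfun_pintegrable. Qed.

Lemma Udelta0_Usupp u : Udelta0 p delta w Omega u -> Usupp (u \_ Omega).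
Proof.
move=> [/(Lp_on_pintegrable _ _ _ (ltW p1)) ui /(Lp_on_pintegrable _ _ _ (ltW p1)) gi].
by split; [exact: patch_patch|exact: ui|rewrite /sqgrad nlgrad_patch].
Qed.

Lemma Usupp_Udelta0 u : Usupp u -> Udelta0 p delta w Omega u.
Proof.
move=> [us ui gi]; split; apply/(Lp_on_pintegrable _ _ _ (ltW p1)) => //.
by rewrite us.
Qed.

Lemma sqgrad_lin u v t :
  sqgrad (fun x => u x + t * v x) = (fun z => sqgrad u z + t * sqgrad v z).
Proof.
apply/funext => z; rewrite /sqgrad !restrict0E.
case: ifP => _; last by rewrite mulr0 addr0.
rewrite /nlgrad !restrict0E.
by case: (z.1 \in Omega); case: (z.2 \in Omega) => /=; ring.
Qed.

Lemma Usupp0 : Usupp (cst 0).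
Proof.
have p0 : p != 0 by rewrite gt_eqF// (lt_trans ltr01).
have sq0 : sqgrad (cst 0) = cst 0.
  apply/funext => z; rewrite /sqgrad /nlgrad !restrict0E.
  case: ifP => // _; case: ifP => _; case: ifP => _; by rewrite subrr mul0r.
have pint0 d (T : measurableType d) (m : {measure set T -> \bar R}) :
    pintegrable m p (cst 0 : T -> R).
  split => //; rewrite (_ : EFin \o _ = cst 0%E); first exact: integrable0.
  by apply/funext => x; rewrite /= normr0 powR0.
split; [|exact: pint0|by rewrite sq0; exact: pint0].
by apply/funext => x; rewrite restrict0E; case: ifP.
Qed.

Lemma Usupp_lin u v t : Usupp u -> Usupp v -> Usupp (fun x => u x + t * v x).
Proof.
move=> [us ui gui] [vs vi gvi]; split.
- apply/funext => x; rewrite restrict0E; case: ifPn => // Ox.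
  by rewrite -us -vs !restrict0E (negbTE Ox) mulr0 addr0.
- by apply: (pintegrableD p1 pq) => //; exact: pintegrableZ.
- by rewrite sqgrad_lin; apply: (pintegrableD p1 pq) => //; exact: pintegrableZ.
Qed.

Lemma measurable_sqgrad v : v \_ Omega = v -> measurable_fun setT v ->
  measurable_fun setT (sqgrad v).
Proof.
move=> vs mv.
have mS : measurable S by apply: measurableX; exact: measurable_enlarge.
apply/(measurable_restrictT _ mS); apply: measurable_funTS.
rewrite /nlgrad vs; apply: measurable_funM.
  by apply: measurable_funB; apply: measurableT_comp.
apply: (measurableT_comp mw); apply: measurable_fun_rV => i.
rewrite (_ : (fun _ => _) = fun z : X * X => z.1 0 i - z.2 0 i); last first.
  by apply/funext => z; rewrite !mxE.
by apply: measurable_funB; apply: (measurableT_comp (measurable_coord i));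
  [exact: measurable_fst|exact: measurable_snd].
Qed.

Lemma Usupp_closed (u_ : nat -> X -> R) u : (forall j, Usupp (u_ j)) ->
  pintegrable mu p u -> {ae mu, forall x, u_ ^~ x @ \oo --> u x} ->
  exists v, [/\ {ae mu, forall x, u x = v x}, measurable_fun setT v,
    measurable_fun setT (sqgrad v),
    {ae mu2, forall z, (fun j => sqgrad (u_ j) z) @ \oo --> sqgrad v z} &
    pintegrable mu p v -> pintegrable mu2 p (sqgrad v) -> Usupp v].
Proof.
move=> Uu_ [mu_ _] uu; have [N [mN N0 subN]] := uu.
(* Off [N] the value is a limit of functions vanishing off [Omega], and on [N] it is 0, so [v]
   vanishes off [Omega] everywhere and not merely almost everywhere, as [Usupp] demands. *)
pose v := u \_ (~` N).
have uv x : ~ N x -> v x = u x by move=> Nx; rewrite /v restrict0E mem_set.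
have aeN : {ae mu, forall x, ~ N x} by exists N; split => // x /= /contrapT.
have cvgN x : ~ N x -> u_ ^~ x @ \oo --> v x.
  by move=> Nx; rewrite uv//; apply: contrapT => h; apply: Nx; exact: subN.
have vs : v \_ Omega = v.
  apply/funext => x; rewrite [LHS]restrict0E; case: ifPn => // Ox.
  have [Nx|Nx] := pselect (N x).
    by rewrite /v restrict0E memNset// => /(_ Nx).
  have := cvgN _ Nx; rewrite (_ : u_ ^~ x = fun=> 0); last first.
    apply/funext => j; have [<- _ _] := Uu_ j.
    by rewrite restrict0E (negbTE Ox).
  by move/(cvg_unique _ (@cvg_cst _ 0 _ _ _)); apply.
have mv : measurable_fun setT v.
  apply/(measurable_restrictT _ (measurableC mN)).
  exact: measurable_funTS.
exists v; split => //.
- by apply: filterS aeN => x /uv.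
- exact: measurable_sqgrad.
- have := ae_product_measure aeN aeN; apply: filterS => z [N1 N2].
  rewrite /sqgrad; under eq_cvg do rewrite restrict0E.
  rewrite restrict0E; case: ifP => _; last exact: cvg_cst.
  rewrite /nlgrad vs; apply: cvgM; last exact: cvg_cst.
  have uE j : u_ j \_ Omega = u_ j by have [] := Uu_ j.
  under eq_cvg do rewrite uE.
  by apply: cvgB; exact: cvgN.
Qed.

End nonlocal_gradient.

(** * Duality *)

Section weighted_young.
Context {R : realType}.
Variables p q : R.
Hypotheses (p1 : 1 < p) (pq : p^-1 + q^-1 = 1).
Let p0 : 0 < p. Proof. exact: lt_trans p1. Qed.
Let q0 : 0 < q. Proof. exact: lt_trans ltr01 (conjugate_gt1r p1 pq). Qed.

(** Young's inequality for c^(1/p) |y| and c^(-1/p) |x|. Since -q/p = 1 - q, the second factor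
    produces exactly the weight of the primal cost. *)
Lemma weighted_young (c x y : R) : 0 < c ->
  x * y <= p^-1 * (c * `|y| `^ p) + q^-1 * (c `^ (1 - q) * `|x| `^ q).
Proof.
move=> c0; have cp0 : 0 < c `^ p^-1 by rewrite powR_gt0.
have := conjugate_powR (mulr_ge0 (ltW cp0) (normr_ge0 y))
  (mulr_ge0 (powR_ge0 c (- p^-1)) (normr_ge0 x)) p0 q0 pq.
rewrite [c `^ p^-1 * _ * _]mulrACA {1}powRN mulfV ?gt_eqF// mul1r -normrM.
rewrite !powRM ?powR_ge0// -!powRrM mulVf ?gt_eqF// powRr1 ?(ltW c0)//.
have -> : - p^-1 * q = 1 - q.
  have -> : p^-1 = 1 - q^-1 by rewrite -pq addrK.
  by field; rewrite gt_eqF.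
by rewrite ![_^-1 * _]mulrC (mulrC x); apply: le_trans; exact: ler_norm.
Qed.

Lemma weighted_young_eq (c y : R) : 0 < c ->
  c `^ (1 - q) * `|c * spow (p - 1) y| `^ q = c * `|y| `^ p.
Proof.
move=> c0; have pB0 : p - 1 != 0 by rewrite gt_eqF// subr_gt0.
rewrite normrM normr_spow// ger0_norm ?(ltW c0)// powRM ?powR_ge0 ?(ltW c0)//.
rewrite -powRrM conjugateB1M// mulrA -powRD ?subrK ?powRr1 ?(ltW c0)//.
by rewrite gt_eqF ?implybT.
Qed.

End weighted_young.

Section duality.
Context {R : realType} {n : nat}.
Variables (p q delta : R) (w : 'rV[R]_n -> R) (Omega : set 'rV[R]_n).
Variables (f : 'rV[R]_n -> R) (kmin kmax : R).
Hypotheses (p1 : 1 < p) (pq : p^-1 + q^-1 = 1).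
Hypotheses (mw : measurable_fun setT w) (oOmega : open Omega).
Hypothesis fL : Lp_on (lebesgue_rV n) Omega q%:E f.
Hypotheses (kmin0 : 0 < kmin) (kminmax : kmin <= kmax).

Local Notation X := 'rV[R]_n.
Local Notation mu := (lebesgue_rV n).
Local Notation mu2 := (lebesgue_rV n \x lebesgue_rV n)%E.
Local Notation S := (square Omega delta).
Implicit Types (u v : X -> R) (k sigma : X * X -> R).

Let p0 : 0 < p. Proof. exact: lt_trans p1. Qed.
Let q1 : 1 < q. Proof. exact: conjugate_gt1r p1 pq. Qed.
Let q0 : 0 < q. Proof. exact: lt_trans ltr01 q1. Qed.

(** Stated with [k] rather than [clamp k], so that the first integral is literally a
    [Linfty_pairing] of [k]. *)
Definition dual_energy u k : R :=
  - (p^-1 * \int[mu2]_(z in S) (k z * `|nlgrad w Omega u z| `^ p)) -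
  \int[mu]_(x in Omega) (f x * u x).

(* An everywhere bounded representative of the conductivity [k]. *)
Definition clamp k z : R := Num.min (Num.max ((k \_ S) z) kmin) kmax.

Lemma clamp_bounds k z : kmin <= clamp k z <= kmax.
Proof. by rewrite /clamp le_min ge_min kminmax le_max !lexx !orbT. Qed.

Lemma clamp_gt0 k z : 0 < clamp k z.
Proof. by rewrite (lt_le_trans kmin0)//; case/andP : (clamp_bounds k z). Qed.

Section conductivity.
Variable k : X * X -> R.
Hypothesis mk : measurable_fun setT (k \_ S).
Hypothesis kb : {ae mu2, forall z, S z -> kmin <= k z <= kmax}.

Lemma measurable_clamp : measurable_fun setT (clamp k).
Proof.
by apply: measurable_minr => //; apply: measurable_maxr.
Qed.

Lemma ae_clamp : {ae mu2, forall z, S z -> k z = clamp k z}.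
Proof.
apply: filterS kb => z kz Sz; have /andP[k1 k2] := kz Sz.
by rewrite /clamp restrict0E mem_set// max_l// min_l.
Qed.

Lemma Rintegral_clamp u : measurable_fun setT (sqgrad delta w Omega u) ->
  \int[mu2]_(z in S) (k z * `|nlgrad w Omega u z| `^ p) =
  \int[mu2]_z (clamp k z * `|sqgrad delta w Omega u z| `^ p).
Proof.
move=> mu_; rewrite Rintegral_mkcond.
have E : (fun z => k z * `|nlgrad w Omega u z| `^ p) \_ S =
    (fun z => (k \_ S) z * `|sqgrad delta w Omega u z| `^ p).
  apply/funext => z; rewrite /sqgrad !restrict0E; case: ifP => // _.
  by rewrite mul0r.
rewrite E; apply: ae_eq_Rintegral.
- by apply: measurable_funM => //; exact: measurable_normr_powR.
- by apply: measurable_funM; [exact: measurable_clamp|exact: measurable_normr_powR].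
- apply: filterS ae_clamp => z kz; rewrite /sqgrad !restrict0E.
  case: ifPn => [/set_mem/kz ->//|_].
  by rewrite normr0 powR0 ?gt_eqF// !mulr0.
Qed.

Lemma integral_clamp sigma : measurable_fun setT (sigma \_ S) ->
  (\int[mu2]_(z in S) (k z `^ (1 - q) * `|sigma z| `^ q)%:E =
  \int[mu2]_z (clamp k z `^ (1 - q) * `|(sigma \_ S) z| `^ q)%:E)%E.
Proof.
move=> ms; rewrite integral_mkcond.
(* [powR] sends 0 to 0 at every nonzero exponent, even a negative one, so the restricted integrands
   agree off [S] as well. *)
have qB0 : 1 - q != 0 by rewrite lt_eqF// subr_lt0.
have E : (fun z => (k z `^ (1 - q) * `|sigma z| `^ q)%:E) \_ S =
    (fun z => ((k \_ S) z `^ (1 - q) * `|(sigma \_ S) z| `^ q)%:E).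
  apply/funext => z; rewrite [LHS]patchE !restrict0E; case: ifP => // _.
  by rewrite powR0// mul0r.
rewrite E; apply: ge0_ae_eq_integral => //.
- apply/measurable_EFinP; apply: measurable_funM; last exact: measurable_normr_powR.
  exact: (measurableT_comp (measurable_powR _)).
- apply/measurable_EFinP; apply: measurable_funM; last exact: measurable_normr_powR.
  by apply: (measurableT_comp (measurable_powR _)); exact: measurable_clamp.
- by move=> z _; rewrite lee_fin mulr_ge0 ?powR_ge0.
- by move=> z _; rewrite lee_fin mulr_ge0 ?powR_ge0.
- apply: filterS ae_clamp => z kz _; rewrite !restrict0E.
  case: ifPn => [/set_mem/kz ->//|_].
  by rewrite normr0 [0 `^ q]powR0 ?gt_eqF// !mulr0.
Qed.

Lemma patchM T (D : set T) (a b : T -> R) :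
  (fun x => a x * b x) \_ D = (fun x => (a \_ D) x * (b \_ D) x).
Proof.
by apply/funext => x; rewrite !restrict0E; case: ifP => //; rewrite mul0r.
Qed.

Lemma dual_energy_le_ihat u : Udelta0 p delta w Omega u ->
  ((dual_energy u k)%:E <= ihat p q delta w Omega f k)%E.
Proof.
move=> Uu; apply: le_ereal_inf_tmp => _ [sigma [sL _ sdiv] <-].
have [_ /(Lp_on_pintegrable _ _ _ (ltW p1)) gi] := Uu.
move: sL => /(Lp_on_pintegrable _ _ _ (ltW q1)) si.
have [mg gI] := gi; have [ms sI] := si.
rewrite integral_clamp// /dual_energy Rintegral_clamp// sdiv// opprK.
rewrite [\int[_]_(z in S) _]Rintegral_mkcond patchM -/(sqgrad _ _ _ _).
set c := clamp k; set s := sigma \_ S; set g := sqgrad _ _ _ _.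
(* As [1 - q] is negative, the weight is at most its value at [kmin]; every admissible flux has
   finite cost, and the comparison can be made between real integrals. *)
have cI : mu2.-integrable setT (EFin \o (fun z => c z `^ (1 - q) * `|s z| `^ q)).
  apply: (@le_integrable_normr _ _ _ _ _ (fun z => kmin `^ (1 - q) * `|s z| `^ q)).
  - apply: measurable_funM; last exact: measurable_normr_powR.
    by apply: (measurableT_comp (measurable_powR _)); exact: measurable_clamp.
  - move=> z; rewrite ger0_norm ?mulr_ge0 ?powR_ge0// ler_wpM2r ?powR_ge0//.
    have -> : 1 - q = - (q - 1) by rewrite opprB.
    rewrite !powRN lef_pV2 ?posrE ?powR_gt0 ?clamp_gt0//.
    apply: ge0_ler_powR; rewrite ?nnegrE ?subr_ge0 ?(ltW q1)//.
    + exact: ltW.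
    + by rewrite ltW// clamp_gt0.
    + by case/andP : (clamp_bounds k z).
  - exact: integrableZl_EFin.
have kI : mu2.-integrable setT (EFin \o (fun z => c z * `|g z| `^ p)).
  by apply: (integrable_weight measurable_clamp kmin0 (clamp_bounds k)).
have sgI := pintegrable_integrableM p1 pq si gi.
rewrite -EFin_Rintegral// -EFinM lee_fin.
suff : \int[mu2]_z (s z * g z) <= p^-1 * \int[mu2]_z (c z * `|g z| `^ p) +
    q^-1 * \int[mu2]_z (c z `^ (1 - q) * `|s z| `^ q) by lra.
rewrite -!RintegralZl// -RintegralD//; try exact: integrableZl_EFin.
apply: le_Rintegral => //.
  by apply: integrableD_EFin; exact: integrableZl_EFin.
by move=> z _; apply: weighted_young => //; exact: clamp_gt0.
Qed.

Lemma ihat_le_dual_energy (C : R) : 0 <= C ->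
  nonlocal_poincare p delta w Omega C ->
  exists2 u, Udelta0 p delta w Omega u &
    (ihat p q delta w Omega f k <= (dual_energy u k)%:E)%E.
Proof.
move=> C0 poin; have fi := (Lp_on_pintegrable _ _ _ (ltW q1)).1 fL.
pose U := Usupp p delta w Omega; pose G := sqgrad delta w Omega.
have U_p u : U u -> pintegrable mu p u by case.
have U_G u : U u -> pintegrable mu2 p (G u) by case.
have Cp0 : 0 <= C `^ p by exact: powR_ge0.
have poin' u : U u ->
    \int[mu]_x (`|u x| `^ p) <= C `^ p * \int[mu2]_z (`|G u z| `^ p).
  move=> Uu; have [us ui gi] := Uu.
  apply: Lnorm_le_Rintegral => //.
  have := poin _ (Usupp_Udelta0 p1 Uu).
  by rewrite /Lp_norm_on us.
have Ucl := @Usupp_closed R n p delta w Omega mw oOmega.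
have mc := measurable_clamp.
have [u Uu umin] := energy_minimiser p1 pq mc kmin0 (clamp_bounds k) fi
  (Usupp0 _ _ _ p1) (fun u v t => @Usupp_lin _ _ _ _ _ _ _ p1 pq u v t)
  (@sqgrad_lin _ _ _ _ _) U_p U_G Cp0 poin' Ucl.
have EL := energy_euler_lagrange p1 pq mc kmin0 (clamp_bounds k) fi
  (fun u v t => @Usupp_lin _ _ _ _ _ _ _ p1 pq u v t)
  (@sqgrad_lin _ _ _ _ _) U_p U_G Uu umin.
exists u; first exact: (Usupp_Udelta0 p1).
have [us ui gi] := Uu; have [mg gI] := gi.
pose sigma z := clamp k z * spow (p - 1) (G u z).
have GuS z : z \notin S -> G u z = 0.
  by move=> zS; rewrite /G /sqgrad restrict0E (negbTE zS).
have sS : sigma \_ S = sigma.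
  apply/funext => z; rewrite restrict0E; case: ifPn => // /GuS gz.
  by rewrite /sigma gz spow_ge0E// ?powR0 ?mulr0// gt_eqF// subr_gt0.
have kI := integrable_weight mc kmin0 (clamp_bounds k) gI.
have ms : measurable_fun setT sigma.
  apply: measurable_funM => //; apply: (measurableT_comp _ mg).
  by apply: continuous_measurable_fun; apply: continuous_spow; rewrite subr_gt0.
have costE z : clamp k z `^ (1 - q) * `|sigma z| `^ q = clamp k z * `|G u z| `^ p.
  exact: (weighted_young_eq p1 pq _ (clamp_gt0 k z)).
(* The identity [costE] expresses |sigma|^q as the weight to the power [q - 1] times the energy
   density, and that weight is at most [kmax]. *)
have si : pintegrable mu2 q sigma.
  split => //; apply: (@le_integrable_normr _ _ _ _ _
      (fun z => kmax `^ (q - 1) * (clamp k z * `|G u z| `^ p))).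
  - exact: measurable_normr_powR.
  - move=> z; rewrite -costE ger0_norm ?powR_ge0// mulrA ler_peMl ?powR_ge0//.
    have -> : 1 - q = - (q - 1) by rewrite opprB.
    rewrite powRN ler_pdivlMr ?powR_gt0 ?clamp_gt0// mul1r.
    have /andP[c1 c2] := clamp_bounds k z.
    apply: ge0_ler_powR; rewrite ?nnegrE ?subr_ge0 ?(ltW q1)//.
    + by rewrite ltW// clamp_gt0.
    + by rewrite (le_trans _ kminmax)// ltW.
  - exact: integrableZl_EFin.
have sQ : Qdelta p q delta w Omega f sigma.
  split => //.
  - by apply/(Lp_on_pintegrable _ _ _ (ltW q1)); rewrite sS.
  - move=> v Uv; have := EL _ (Udelta0_Usupp p1 Uv).
    rewrite /sqgrad nlgrad_patch => /eqP; rewrite addrC addr_eq0 => /eqP ELv.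
    rewrite [\int[_]_(x in Omega) _]Rintegral_mkcond patchM ELv.
    rewrite [\int[_]_(x in S) _]Rintegral_mkcond patchM sS.
    by congr (- _); apply: eq_Rintegral => z _; rewrite /sigma mulrA.
apply: (@le_trans _ _ (q^-1%:E *
    \int[mu2]_(z in S) (k z `^ (1 - q) * `|sigma z| `^ q)%:E)%E).
  by apply: ereal_inf_lbound; exists sigma.
rewrite integral_clamp ?sS// -EFin_Rintegral; last first.
  by under [X in EFin \o X]eq_fun do rewrite costE.
under eq_Rintegral do rewrite costE.
rewrite -EFinM lee_fin /dual_energy Rintegral_clamp//.
rewrite [\int[_]_(x in Omega) _]Rintegral_mkcond patchM us.
(* Testing the equation with [u] itself identifies the integral of [f * u] with minus that of k |G
   u|^p. With 1/q = 1 - 1/p, the primal cost of [sigma] then equals the dual energy of [u]. *)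
have := EL _ Uu; under eq_Rintegral do rewrite spowM//.
have -> : q^-1 = 1 - p^-1 by rewrite -pq addrAC subrr add0r.
by rewrite -/(sqgrad _ _ _ _) -/G; lra.
Qed.

End conductivity.

End duality.

(** * Existence of an optimal conductivity *)

Unset Implicit Arguments.

Theorem theorem3p1 (R : realType) (n : nat) (hn : (2 <= n)%N)
  (p q : R) (hp : 1 < p) (hpq : p^-1 + q^-1 = 1)
  (Omega : set 'rV[R]_n) (hOmega : bounded_lipschitz_domain Omega)
  (e : 'rV[R]_n) (he : esphere e)
  (w : R -> 'rV[R]_n -> R) (hw : forall delta : R, 0 < delta ->
    nlkernel p e delta (w delta))
  (delta_bar C : R) (hdelta_bar : 0 < delta_bar) (hC : 0 < C)
  (hpoincare : forall delta : R, 0 < delta < delta_bar ->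
    nonlocal_poincare p delta (w delta) Omega C)
  (kmin kmax : R) (hkmin : 0 < kmin) (hkmax : kmin <= kmax)
  (delta : R) (hdelta : 0 < delta < delta_bar)
  (A : set ('rV[R]_n * 'rV[R]_n -> R))
  (hA : conductivities delta Omega kmin kmax A)
  (f : 'rV[R]_n -> R) (hf : Lp_on (lebesgue_rV n) Omega q%:E f) :
  exists2 kstar, A kstar &
    ihat p q delta (w delta) Omega f kstar =
    ereal_inf [set ihat p q delta (w delta) Omega f k | k in A].
Proof.
have [_ oOmega _ _ _] := hOmega.
have delta0 : 0 < delta by case/andP : hdelta.
have [mw _ _ _ _] := hw _ delta0.
have [A0 AL _ Acpt Abnd] := hA.
have mA k : A k -> measurable_fun setT (k \_ (square Omega delta)).
  by move=> /AL; rewrite /Lp_on/= inE => /andP[/[!inE]].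
have kb k : A k -> {ae (lebesgue_rV n \x lebesgue_rV n)%E, forall z,
    square Omega delta z -> kmin <= k z <= kmax}.
  by move=> /Abnd; apply: filterS => z kz /kz[].
pose S := square Omega delta.
pose mu2 := (lebesgue_rV (R := R) n \x lebesgue_rV n)%E.
pose I := {u | Udelta0 p delta (w delta) Omega u}.
pose J (u : I) := dual_energy p delta (w delta) Omega f (sval u).
(* The cluster point argument asks for no separation axiom, so it applies to conductivities as
   functions, although this topology does not separate representatives of one class. *)
apply: (@compact_max_continuous_attains_inf R
  (initial_topology (Linfty_pairing mu2 S)) I J A _ Acpt A0).
- move=> [u Uu].
  have phiL : Lp_on mu2 S 1%E (fun z => `|nlgrad (w delta) Omega u z| `^ p).
    have [_ /(Lp_on_pintegrable _ _ _ (ltW hp))[_ gi]] := Uu.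
    rewrite /Lp_on/= (_ : _ \_ _ =
      (fun z => `|(nlgrad (w delta) Omega u \_ S) z| `^ p)).
      exact/Lfun1_integrable.
    apply/funext => z; rewrite !restrict0E; case: ifP => // _.
    by rewrite normr0 powR0// gt_eqF// (lt_trans ltr01).
  pose phi : {phi | Lp_on mu2 S 1%E phi} := exist _ _ phiL.
  have cphi : continuous (fun k : initial_topology (Linfty_pairing mu2 S) =>
      Linfty_pairing mu2 S k phi).
    move=> k; have ic := @initial_continuous _ _ (Linfty_pairing mu2 S) k.
    have pc := @proj_continuous {phi | Lp_on mu2 S 1%E phi} (fun=> R) phi
      (Linfty_pairing mu2 S k).
    exact: (cvg_comp _ _ ic pc).
  move=> k.
  exact: (cvgB (cvgN (cvgM (cvg_cst p^-1) (cphi k)))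
    (cvg_cst (\int[lebesgue_rV n]_(x in Omega) (f x * u x)))).
- move=> k Ak [u Uu].
  exact: (dual_energy_le_ihat f hp hpq hkmin hkmax (mA _ Ak) (kb _ Ak) Uu).
- move=> k Ak; have [u Uu le_ku] := ihat_le_dual_energy hp hpq mw oOmega hf hkmin hkmax
    (mA _ Ak) (kb _ Ak) (ltW hC) (hpoincare _ hdelta).
  by exists (exist _ u Uu).
Qed.
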